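(* Let $1\leqslant p\leqslant\infty$ and let $\xi$ be an ordinal with $0<\xi\leqslant\omega_1$. Then $\bigcup_{0<\zeta<\omega^\xi}\mathfrak{SM}_p^\zeta$ is an operator ideal, and it is closed if $\xi=\omega_1$. Moreover, if $p\in\{1,\infty\}$, then $\mathfrak{SM}_p^\xi$ is a closed operator ideal.
   Context: ''Operator'' means bounded linear operator between Banach spaces. A class of operators is closed if each of its components in $\mathfrak{L}(X,Y)$ (the operators $X\to Y$) is norm closed. Schreier families: finite subsets of $\mathbb{N}$ are written in increasing order; $E<F$ means $\max E<\min F$, and $n\leqslant E$ means $n\leqslant\min E$. For families $\mathcal F,\mathcal G$ of finite subsets of $\mathbb N$, $\mathcal F[\mathcal G]=\{\bigcup_{i=1}^nE_i: E_1<\dots<E_n,\ (\min E_i)_{i=1}^n\in\mathcal F,\ E_i\in\mathcal G\}$. Let $\mathcal S=\{E: |E|\leqslant \min E\}\cup\{\varnothing\}$, $\mathcal S_0=\{\varnothing\}\cup\{\{n\}:n\in\mathbb N\}$, $\mathcal S_{\xi+1}=\mathcal S[\mathcal S_\xi]$, and for a countable limit ordinal $\xi$ fix successor ordinals $\xi_n\uparrow\xi$ with $\mathcal S_{\xi_n}\subset\mathcal S_{\xi_{n+1}}$ and let $\mathcal S_\xi=\{E:\exists\, n\leqslant E,\ E\in\mathcal S_{\xi_n}\}$ (together with $\varnothing$). Finally $\mathcal S_{\omega_1}$ is the family of all finite subsets of $\mathbb N$. $(u_i)\lesssim_K(v_i)$ means $\|\sum a_iu_i\|\leqslant K\|\sum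 a_iv_i\|$ for all (finitely supported) scalars. For $0<\xi\leqslant\omega_1$ and $(e_i)$ the canonical basis of $\ell_p$ (of $c_0$ if $p=\infty$), a sequence $(x_i)$ in a Banach space is an $\ell_p^\xi$ spreading model ($c_0^\xi$ spreading model if $p=\infty$) if there are $a,b>0$ with $(e_i)_{i\in E}\lesssim_a(x_i)_{i\in E}$ and $(x_i)_{i\in E}\lesssim_b(e_i)_{i\in E}$ for every $E\in\mathcal S_\xi$. $\mathfrak{SM}_p^\xi$ is the class of all operators $A:X\to Y$ such that whenever $(x_n)\subset X$ is an $\ell_p^\xi$ ($c_0^\xi$ if $p=\infty$) spreading model, $(Ax_n)$ is not an $\ell_p^\xi$ ($c_0^\xi$) spreading model. *)

(* Defs.v *)
From HB Require Import structures.
From mathcomp Require Import all_boot all_order all_algebra finmap.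
From mathcomp Require Import complex.
From mathcomp Require Import all_classical all_reals all_analysis.

Set Implicit Arguments.
Unset Strict Implicit.
Unset Printing Implicit Defensive.

Import Order.TTheory GRing.Theory Num.Theory.
Import numFieldNormedType.Exports.

Local Open Scope classical_set_scope.
Local Open Scope ring_scope.

(* The countable ordinals are the elements of a well-ordered type W of order
   type omega_1: a well-order all of whose proper initial segments are
   countable, while W itself is not, is isomorphic to omega_1.  An ordinal
   [<= omega_1] is an [option W], with [None] standing for omega_1. *)
Definition is_omega1 (d : Order.disp_t) (W : orderType d) : Prop :=
  [/\ well_founded (fun a b : W => (a < b)%O),
      forall a : W, countable [set b : W | (b < a)%O]
    & ~ countable [set: W]].

Definition ord_zero (d : Order.disp_t) (W : orderType d) (z : W) : Prop :=
  forall a : W, (z <= a)%O.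

Definition ord_succ (d : Order.disp_t) (W : orderType d) (a b : W) : Prop :=
  (a < b)%O /\ forall c : W, (a < c)%O -> (b <= c)%O.

Definition ord_limit (d : Order.disp_t) (W : orderType d) (l : W) : Prop :=
  ~ ord_zero l /\ ~ exists a : W, ord_succ a l.

Definition ord_pos (d : Order.disp_t) (W : orderType d) (xi : option W) : Prop :=
  if xi is Some a then ~ ord_zero a else True.

(* Ordinal addition, by recursion on the right argument. *)
Definition ord_addition (d : Order.disp_t) (W : orderType d)
    (add : W -> W -> W) : Prop :=
  forall a : W,
    [/\ forall z, ord_zero z -> add a z = a,
        forall b b', ord_succ b b' -> ord_succ (add a b) (add a b')
      & forall l, ord_limit l ->
          supremums [set add a b | b in [set b : W | (b < l)%O]] (add a l)].

(* [pw a] is omega ^ a: omega ^ 0 = 1, omega ^ (a + 1) = omega ^ a * omega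
   = sup_n (omega ^ a * n), and omega ^ l is the supremum of the smaller
   powers.  Here [iter n (add^~ (pw a)) z] is omega ^ a * n. *)
Definition omega_power (d : Order.disp_t) (W : orderType d)
    (pw : W -> W) : Prop :=
  exists2 add : W -> W -> W, ord_addition add &
    [/\ forall z, ord_zero z -> ord_succ z (pw z),
        forall z a b, ord_zero z -> ord_succ a b ->
          supremums (range (fun n : nat => iter n (add^~ (pw a)) z)) (pw b)
      & forall l, ord_limit l ->
          supremums [set pw a | a in [set a : W | (a < l)%O]] (pw l)].

(* zeta < omega ^ xi; for xi = omega_1 the power is the supremum of the
   omega ^ a with a countable, that is, omega_1. *)
Definition lt_omega_power (d : Order.disp_t) (W : orderType d) (pw : W -> W)
    (zeta : W) (xi : option W) : Prop :=
  if xi is Some a then (zeta < pw a)%O else exists a : W, (zeta < pw a)%O.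

(* The set N of the Schreier families is {1, 2, ...}: with 0 in N, {0} would
   be in S_0 but not in S_1.  All families below consist of finite sets of
   positive integers, and the term [x 0] of a sequence is never used. *)
Definition fmin (E : {fset nat}) : nat := head 0%N (sort leq E).

Definition before (E F : {fset nat}) : bool :=
  all (fun i => all (fun j => (i < j)%N) F) E.

Definition schreier_comp (F G : set {fset nat}) : set {fset nat} :=
  [set E : {fset nat} | exists Es : seq {fset nat},
    [/\ E = (\bigcup_(A <- Es) A)%fset,
        pairwise before Es,
        F [fset i | i in map fmin Es]%fset
      & forall A, A \in Es -> A != fset0 /\ G A]].

Definition schreier0 : set {fset nat} :=
  [set E : {fset nat} | E = fset0 \/ exists2 n : nat, (0 < n)%N & E = [fset n]%fset].

Definition schreier1 : set {fset nat} :=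
  [set E : {fset nat} | E = fset0 \/ (#|` E| <= fmin E)%N].

(* [S] is a transfinite Schreier sequence, for some choice of approximating
   sequences at the limit ordinals.  The approximating sequence is indexed
   from 1, so xi_(n+1) is [xs n] and the condition n + 1 <= E reads n < E. *)
Definition schreier_families (d : Order.disp_t) (W : orderType d)
    (S : W -> set {fset nat}) : Prop :=
  [/\ forall z, ord_zero z -> S z = schreier0,
      forall a b, ord_succ a b -> S b = schreier_comp schreier1 (S a)
    & forall l, ord_limit l -> exists xs : nat -> W,
        [/\ forall n, exists a, ord_succ a (xs n),
            forall n, (xs n < xs n.+1)%O,
            supremums (range xs) l,
            forall n, S (xs n) `<=` S (xs n.+1)
          & S l = [set E : {fset nat} | E = fset0 \/
                     exists n : nat, (forall i, i \in E -> (n < i)%N) /\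
                                     S (xs n) E]]].

Definition schreier (d : Order.disp_t) (W : orderType d)
    (S : W -> set {fset nat}) (xi : option W) : set {fset nat} :=
  if xi is Some a then S a else [set E : {fset nat} | forall i, i \in E -> (0 < i)%N].

(* Banach spaces are real or complex. *)
Variant scalar_kind := RealScalars | ComplexScalars.

Definition scalars (R : realType) (k : scalar_kind) : numFieldType :=
  match k with RealScalars => R | ComplexScalars => R[i] end.

(* Norms of a normed module over K are elements of K; on them, [real_part]
   is the inverse of the embedding of R in K. *)
Definition real_part (R : realType) (k : scalar_kind) : scalars R k -> R :=
  match k return scalars R k -> R with
  | RealScalars => fun x => x
  | ComplexScalars => fun x => complex.Re x
  end.

(* The norm of \sum_(i in E) c_i e_i in l_p, resp. in c_0 for p = +oo. *)
Definition lp_norm (R : realType) (k : scalar_kind) (p : \bar R)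
    (E : {fset nat}) (c : nat -> scalars R k) : R :=
  match p with
  | EFin r => (\sum_(i <- E) real_part `|c i| `^ r) `^ r^-1
  | +oo%E => \big[Num.max/0]_(i <- E) real_part `|c i|
  | -oo%E => 0
  end.

Definition lin_norm (R : realType) (k : scalar_kind)
    (X : completeNormedModType (scalars R k)) (x : nat -> X)
    (E : {fset nat}) (c : nat -> scalars R k) : R :=
  real_part `|\sum_(i <- E) c i *: x i|.

Definition spreading_model (R : realType) (k : scalar_kind) (p : \bar R)
    (F : set {fset nat}) (X : completeNormedModType (scalars R k))
    (x : nat -> X) : Prop :=
  exists a b : R, [/\ 0 < a, 0 < b &
    forall E, F E -> forall c : nat -> scalars R k,
      lp_norm p E c <= a * lin_norm x E c /\
      lin_norm x E c <= b * lp_norm p E c].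

Definition bounded_operator (K : numFieldType) (X Y : completeNormedModType K)
    (A : {linear X -> Y}) : Prop :=
  exists M : K, forall x : X, `|A x| <= M * `|x|.

Definition operator_class (K : numFieldType) :=
  forall X Y : completeNormedModType K, set {linear X -> Y}.

Definition finite_rank (K : numFieldType) (X Y : completeNormedModType K)
    (A : {linear X -> Y}) : Prop :=
  exists n : nat, exists v : 'I_n -> Y, forall x : X,
    exists c : 'I_n -> K, A x = \sum_i c i *: v i.

Definition operator_ideal (K : numFieldType) (J : operator_class K) : Prop :=
  [/\ forall (X Y : completeNormedModType K) (A : {linear X -> Y}),
        J X Y A -> bounded_operator A,
      forall (X Y : completeNormedModType K) (A : {linear X -> Y}),
        bounded_operator A -> finite_rank A -> J X Y A,
      forall (X Y : completeNormedModType K) (A B : {linear X -> Y}),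
        J X Y A -> J X Y B -> J X Y (A \+ B),
      forall (X Y : completeNormedModType K) (t : K) (A : {linear X -> Y}),
        J X Y A -> J X Y (t \*: A)
    & forall (V X Y Z : completeNormedModType K)
        (C : {linear V -> X}) (A : {linear X -> Y}) (B : {linear Y -> Z}),
        bounded_operator C -> J X Y A -> bounded_operator B ->
        J V Z (B \o (A \o C))].

(* Each component is closed in the operator norm of the bounded operators. *)
Definition closed_class (K : numFieldType) (J : operator_class K) : Prop :=
  forall (X Y : completeNormedModType K) (A : {linear X -> Y}),
    bounded_operator A ->
    (forall e : K, 0 < e ->
       exists2 B : {linear X -> Y}, J X Y B &
         forall x : X, `|A x - B x| <= e * `|x|) ->
    J X Y A.

(* [SM k p F] with F = S_xi is the class SM_p^xi. *)
Definition SM (R : realType) (k : scalar_kind) (p : \bar R)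
    (F : set {fset nat}) : operator_class (scalars R k) :=
  fun X Y => [set A | bounded_operator A /\
    forall x : nat -> X, spreading_model p F x ->
      ~ spreading_model p F (A \o x)].

Definition SM_below (R : realType) (k : scalar_kind) (p : \bar R)
    (d : Order.disp_t) (W : orderType d) (pw : W -> W)
    (S : W -> set {fset nat}) (xi : option W) : operator_class (scalars R k) :=
  fun X Y => \bigcup_(zeta in [set z | ord_pos (Some z) /\
                                       lt_omega_power pw z xi])
    @SM R k p (schreier S (Some zeta)) X Y.

(* Main.v *)
From mathcomp Require Import all_boot all_order all_algebra finmap.
From mathcomp Require Import complex.
From mathcomp Require Import all_classical all_reals all_analysis.
From mathcomp Require Import zify ring lra.
Require Import Defs.

(** Everything but the stability under sums is soft.  An operator always
    transports upper estimates, so that A fails to be in SM_p^F exactly when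
    some spreading model on F has an image with a lower estimate ([SM_P]).
    Lower estimates survive small perturbations, hence each class is norm
    closed; they exclude finite rank because the families contain sets of any
    given size.  The classes increase with the ordinal, since a tail of S_a is
    contained in S_b for a < b and the families are spreading.  For
    xi = omega_1 closedness then follows as a sequence of countable ordinals is
    bounded by a countable one.

    Sums, for all p and along growing ordinals ([SM_add_blocks]).  Let A and B
    be in SM_p^a.  If x has an l_p lower estimate along S_(a + a), which along a
    subsequence contains S_a[S_a] ([Sq_comp_sub]), then A x loses the lower
    estimate on every tail of S_a; this gives successive normalised blocks w_n
    on which A is as small as desired.  They form an l_p^a spreading model.  A
    lower estimate for (A + B) x would be inherited by B w, contrary to the
    choice of B.  As omega ^ xi is closed under addition, this proves the first
    claim; the family of all finite sets is handled in the same way.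

    Sums for p = oo ([SM_c0_add]).  A c_0 upper estimate forces averages to tend
    to 0, which makes a sequence with norms bounded below almost basic along a
    subsequence, hence a c_0 spreading model.  So A x tends to 0 in norm for
    every c_0 spreading model x when A is in the class, and this is stable under
    sums.

    Sums for p = 1 ([SM_l1_add]).  Here S_xi itself has to be kept.  Suppose
    that y + z has an l_1 lower estimate on S_xi.  By the Hahn-Banach theorem
    there are, for every set in S_xi, functionals of norm at most 1 which take
    values of a fixed size and alternating signs on y + z; over each pair of
    consecutive points such a functional oscillates by a fixed amount on y or on
    z, between finitely many approximate values.  This colours the pairs.  The
    Ramsey theory is done with a free ultrafilter: [large xi] is a quantifier on finite sequences modelled
    on S_xi and iterated along the ultrafilter, and the indecomposability of
    omega ^ xi becomes [large_split]: if almost all sequences can be distributed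
    over two hereditary families, one of the families is large.  So the same
    colour is available for almost all sequences, and a fusion argument
    ([fusion], [large_extract]) yields a subsequence on which all signs are
    available for y, say.  Differences of functionals for opposite signs give
    the l_1 lower estimate for that subsequence of y, as in the theorems of
    Rosenthal and Dor for l_1. *)

Set Implicit Arguments.
Unset Strict Implicit.
Unset Printing Implicit Defensive.

Import Order.TTheory GRing.Theory Num.Theory.
Import numFieldNormedType.Exports.

Local Open Scope classical_set_scope.
Local Open Scope ring_scope.

(** * Countable ordinals *)

Section Ordinals.
Variables (d : Order.disp_t) (W : orderType d).
Hypothesis hW : is_omega1 W.

Lemma ord_ind (P : W -> Prop) :
  (forall a, (forall b, (b < a)%O -> P b) -> P a) -> forall a, P a.
Proof. by case: hW => wf _ _ IH a; elim: (wf a) => {}a _; apply: IH. Qed.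

Lemma ord_min (P : W -> Prop) :
  (exists a, P a) -> exists a, P a /\ forall b, P b -> (a <= b)%O.
Proof.
case=> a Pa; apply: contrapT => noP; move: Pa; elim/ord_ind: a => a IH Pa.
apply: noP; exists a; split=> // b Pb; rewrite leNgt.
by apply/negP => ltba; apply: (IH _ ltba Pb).
Qed.

Lemma ord_succ_le (a b : W) : (a < b)%O -> exists2 c, ord_succ a c & (c <= b)%O.
Proof.
move=> ltab; have [|c [ltac cmin]] := @ord_min (fun c => (a < c)%O).
  by exists b.
by exists c; [split | apply: cmin].
Qed.

Lemma ord_succ_leP (a b c : W) : ord_succ a b -> (c < b)%O -> (c <= a)%O.
Proof.
by move=> [_ bmin] ltcb; rewrite leNgt; apply: contraL ltcb => /bmin; rewrite -leNgt.
Qed.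

Lemma ord_zero_ex : exists z : W, ord_zero z.
Proof.
have [|z [_ zmin]] := @ord_min (fun=> True); last by exists z => a; apply: zmin.
apply: contrapT => noW; case: hW => _ _; apply.
by rewrite (_ : [set: W] = set0) // -subset0 => a _; apply: noW; exists a.
Qed.

Lemma ord_pos_lt (a z : W) : ord_zero z -> ~ ord_zero a -> (z < a)%O.
Proof.
move=> z0 a0; rewrite lt_neqAle z0 andbT; apply/eqP => za.
by apply: a0; rewrite -za.
Qed.

Lemma ord_lt_pos (a b : W) : (a < b)%O -> ~ ord_zero b.
Proof. by move=> ab /(_ a); rewrite leNgt ab. Qed.

Lemma ord_cases (a : W) :
  [\/ ord_zero a, exists b, ord_succ b a | ord_limit a].
Proof.
have [|a0] := EM (ord_zero a); first by constructor 1.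
by have [|aS] := EM (exists b, ord_succ b a); [constructor 2|constructor 3].
Qed.

Lemma lt_supremums (A : set W) (s x : W) :
  supremums A s -> (x < s)%O -> exists2 y, A y & (x < y)%O.
Proof.
move=> [_ smin] xs; apply: contrapT => noy.
suff /smin : ubound A x by rewrite leNgt xs.
by move=> y Ay; rewrite leNgt; apply/negP => xy; apply: noy; exists y.
Qed.

Lemma ord_limit_lt (l b : W) : ord_limit l -> (b < l)%O ->
  exists2 c, ord_succ b c & (c < l)%O.
Proof.
move=> [_ lS] bl; have [c bc] := ord_succ_le bl.
rewrite le_eqVlt => /orP[/eqP cl|]; last by exists c.
by case: lS; exists b; rewrite -cl.
Qed.

(** Regularity of omega_1: a countable union of countable initial segments is
    countable, hence does not exhaust [W]. *)
Lemma ord_seq_bound (f : nat -> W) : exists b, forall n, (f n <= b)%O.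
Proof.
case: hW => _ cW; apply: contra_notP => nob.
rewrite (_ : [set: W] = \bigcup_n [set b | (b < f n)%O]).
  exact: bigcup_countable.
apply/esym; rewrite -subTset => b _; apply: contrapT => nofn; apply: nob.
exists b => n; rewrite leNgt; apply/negP => bfn; apply: nofn.
by exists n.
Qed.

Lemma ord_succ_ex (a : W) : exists b, ord_succ a b.
Proof.
suff [b /ord_succ_le[c ac _]] : exists b, (a < b)%O by exists c.
case: hW => _ cW; apply: contra_notP => nob.
rewrite (_ : [set: W] =
    \bigcup_(n : nat) (if n is 0%N then [set a] else [set b | (b < a)%O])).
  by apply: bigcup_countable => // -[|n] _; [exact: countable1|exact: cW].
apply/esym; rewrite -subTset => b _; have [ba|ab|->] := ltgtP b a.
- by exists 1%N.
- by case: nob; exists b.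
- by exists 0%N.
Qed.

Lemma ord_increasing_ge (f : W -> W) :
  (forall a b, (a < b)%O -> (f a < f b)%O) -> forall a, (a <= f a)%O.
Proof.
move=> f_incr; elim/ord_ind => a IH; rewrite leNgt; apply/negP => fa.
by have := f_incr _ _ fa; rewrite ltNge IH.
Qed.

Section Addition.
Variable add : W -> W -> W.
Hypothesis addP : ord_addition add.

Lemma add_lt2 (a b c : W) : (b < c)%O -> (add a b < add a c)%O.
Proof.
elim/ord_ind: c b => c IH b bc.
have [_ addS addl] := addP a.
case: (ord_cases c) => [c0|[c' cS]|cl].
- by have := ord_lt_pos bc.
- have [ltS _] := addS _ _ cS.
  have := ord_succ_leP cS bc; rewrite le_eqVlt => /orP[/eqP->//|bc'].
  by apply: lt_trans ltS; apply: IH bc'; case: cS.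
- have [b' bS b'c] := ord_limit_lt cl bc.
  apply: (@lt_le_trans _ _ (add a b')); first by apply: IH => //; case: bS.
  by have [+ _] := addl _ cl; apply; exists b'.
Qed.

Lemma add_le2 (a b c : W) : (b <= c)%O -> (add a b <= add a c)%O.
Proof. by rewrite le_eqVlt => /orP[/eqP->//|/(add_lt2 a) /ltW]. Qed.

Lemma add_le1 (a a' b : W) : (a <= a')%O -> (add a b <= add a' b)%O.
Proof.
move=> aa'; elim/ord_ind: b => b IH.
have [add0 addS addl] := addP a; have [add0' addS' addl'] := addP a'.
case: (ord_cases b) => [b0|[b' bS]|bl].
- by rewrite add0 // add0'.
- have [_] := addS _ _ bS; apply.
  have [lt' _] := addS' _ _ bS.
  by apply: le_lt_trans lt'; apply: IH; case: bS.
- have [_] := addl _ bl; apply => _ [c /= cb <-].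
  by apply: le_trans (IH _ cb) _; apply: add_le2; apply: ltW.
Qed.

Lemma add_ge2 (a b : W) : (b <= add a b)%O.
Proof. by apply: (@ord_increasing_ge (add a)) => b' c; apply: add_lt2. Qed.

Lemma add_ge1 (a b : W) : (a <= add a b)%O.
Proof.
have [z z0] := ord_zero_ex; have [add0 _ _] := addP a.
by rewrite -{1}(add0 _ z0); apply: add_le2.
Qed.

Lemma add_limit (a l : W) : ord_limit l -> ord_limit (add a l).
Proof.
move=> ll; have [_ _ addl] := addP a; have [z z0] := ord_zero_ex.
have zl : (z < l)%O by apply: ord_pos_lt => //; case: ll.
split; first exact: ord_lt_pos (add_lt2 a zl).
case=> e eS; have [c [c' c'l <-] ec] := lt_supremums (addl _ ll) (proj1 eS).
by have [_ /(_ _ ec)] := eS; rewrite leNgt add_lt2.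
Qed.

Lemma add_assoc_le (a b c : W) : (add a (add b c) <= add (add a b) c)%O.
Proof.
elim/ord_ind: c => c IH.
have [_ aS al] := addP a; have [b0 bS bl] := addP b.
have [ab0 abS abl] := addP (add a b).
case: (ord_cases c) => [c0|[c' cS]|cl].
- by rewrite b0 // ab0.
- have [_] := aS _ _ (bS _ _ cS); apply.
  have [lt' _] := abS _ _ cS.
  by apply: le_lt_trans lt'; apply: IH; case: cS.
- have [_] := al _ (add_limit b cl); apply => _ [e /= elt <-].
  have [_ [c' c'c <-] ec'] := lt_supremums (bl _ cl) elt.
  apply: le_trans (add_le2 a (ltW ec')) _.
  by apply: le_trans (IH _ c'c) _; apply: add_le2; apply: ltW.
Qed.

Lemma add_iter_le (z p : W) (n m : nat) : ord_zero z ->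
  (add (iter n (add^~ p) z) (iter m (add^~ p) z) <= iter (n + m) (add^~ p) z)%O.
Proof.
move=> z0; elim: m => [|m IH] /=.
  by rewrite addn0; case: (addP (iter n (add^~ p) z)) => ->.
rewrite addnS /=; apply: le_trans (add_assoc_le _ _ _) _.
exact: add_le1.
Qed.

End Addition.

Variable pw : W -> W.
Hypothesis pwP : omega_power pw.

Lemma pw_le (a b : W) : (a <= b)%O -> (pw a <= pw b)%O.
Proof.
have [add addP [_ pwS pwl]] := pwP.
elim/ord_ind: b => b IH; rewrite le_eqVlt => /orP[/eqP->//|ab].
case: (ord_cases b) => [b0|[b' bS]|bl].
- by have := ord_lt_pos ab.
- have [z z0] := ord_zero_ex.
  apply: (@le_trans _ _ (pw b')).
    by apply: IH; [case: bS | apply: ord_succ_leP bS ab].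
  have [+ _] := pwS _ _ _ z0 bS => /(_ (add z (pw b'))) pwb.
  by apply: le_trans (add_ge2 addP z _) _; apply: pwb; exists 1%N.
- by have [+ _] := pwl _ bl; apply; exists a.
Qed.

Lemma pw_pos (a : W) : ~ ord_zero (pw a).
Proof.
have [add addP [pw0 _ _]] := pwP; have [z z0] := ord_zero_ex.
have [zlt _] := pw0 _ z0.
exact: ord_lt_pos (lt_le_trans zlt (pw_le (z0 a))).
Qed.

Lemma pw_succ_lt (a b : W) : ord_succ a b -> (pw a < pw b)%O.
Proof.
have [add addP [_ pwS _]] := pwP; have [z z0] := ord_zero_ex => abS.
have [+ _] := pwS _ _ _ z0 abS => ub.
apply: (@lt_le_trans _ _ (add (pw a) (pw a))).
  have [add0 _ _] := addP (pw a); rewrite -{1}(add0 _ z0).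
  by apply: add_lt2 => //; apply: ord_pos_lt (@pw_pos a).
apply: (@le_trans _ _ (add (add z (pw a)) (pw a))).
  by apply: add_le1 => //; apply: add_ge2.
by apply: ub; exists 2%N.
Qed.

Lemma pw_lt (a b : W) : (a < b)%O -> (pw a < pw b)%O.
Proof.
by move=> /ord_succ_le[c /pw_succ_lt ac /pw_le]; apply: lt_le_trans.
Qed.

(** omega ^ xi is closed under addition: below omega ^ (a + 1) both summands
    lie below finite multiples of omega ^ a, and these multiples add up. *)
Lemma add_lt_pw (add : W -> W -> W) (x b c : W) :
  ord_addition add ->
  (forall z, ord_zero z -> ord_succ z (pw z)) ->
  (forall z a b, ord_zero z -> ord_succ a b ->
     supremums (range (fun n : nat => iter n (add^~ (pw a)) z)) (pw b)) ->
  (forall l, ord_limit l ->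
     supremums [set pw a | a in [set a : W | (a < l)%O]] (pw l)) ->
  (b < pw x)%O -> (c < pw x)%O -> (add b c < pw x)%O.
Proof.
move=> addP pw0 pwS pwl; elim/ord_ind: x b c => x IH b c bx cx.
case: (ord_cases x) => [x0|[y yS]|xl].
- have /(ord_succ_leP (pw0 _ x0)) lecx := cx.
  have -> : c = x by apply/le_anti; rewrite lecx x0.
  by have [->] := addP b.
- have [z z0] := ord_zero_ex.
  have [_ [n _ <-] bn] := lt_supremums (pwS _ _ _ z0 yS) bx.
  have [_ [m _ <-] cm] := lt_supremums (pwS _ _ _ z0 yS) cx.
  apply: lt_le_trans (add_lt2 addP b cm) _.
  apply: le_trans (add_le1 addP _ (ltW bn)) _.
  apply: le_trans (add_iter_le addP _ _ _ z0) _.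
  by have [+ _] := pwS _ _ _ z0 yS; apply; exists (n + m)%N.
- have [_ [y yx <-] by_] := lt_supremums (pwl _ xl) bx.
  have [_ [y' y'x <-] cy'] := lt_supremums (pwl _ xl) cx.
  wlog yy' : b c y y' yx y'x bx cx by_ cy' / (y <= y')%O => [wh|].
    have [/wh|/ltW y'y] := leP y y'; first exact.
    apply: lt_trans (pw_lt yx); apply: IH => //.
    by apply: lt_le_trans cy' (pw_le y'y).
  apply: lt_trans (pw_lt y'x); apply: IH => //.
  by apply: lt_le_trans by_ (pw_le yy').
Qed.

Lemma lt_omega_power_add (xi : option W) : exists2 add, ord_addition add &
  forall b c, lt_omega_power pw b xi -> lt_omega_power pw c xi ->
    lt_omega_power pw (add b c) xi.
Proof.
have [add addP [pw0 pwS pwl]] := pwP; exists add => // b c.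
case: xi => [x|] /=; first exact: add_lt_pw.
move=> [x bx] [y cy]; exists (Order.max x y).
by apply: add_lt_pw => //; [apply: lt_le_trans bx _ | apply: lt_le_trans cy _];
  apply: pw_le; rewrite le_max lexx ?orbT.
Qed.

Lemma lt_omega_power_None (b : W) : lt_omega_power pw b None.
Proof.
have [c /pw_succ_lt bc] := ord_succ_ex b; exists c; apply: le_lt_trans bc.
by apply: (ord_increasing_ge pw_lt).
Qed.

Lemma lt_omega_power_ex (xi : option W) : ord_pos xi ->
  exists b, ~ ord_zero b /\ lt_omega_power pw b xi.
Proof.
have [z z0] := ord_zero_ex; exists (pw z); split; first exact: pw_pos.
case: xi H => [x|] /= xpos; first by apply: pw_lt; apply: ord_pos_lt.
exact: lt_omega_power_None.
Qed.

End Ordinals.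

(** * Schreier families as families of increasing sequences *)

Local Notation fs s := [fset i | i in s]%fset.

Section FsetSeq.
Implicit Types (s t : seq nat) (E : {fset nat}).

Lemma mem_fs s i : (i \in fs s) = (i \in s).
Proof. by rewrite !inE. Qed.

Lemma sort_fset_sorted E : sorted ltn (sort leq E).
Proof.
by rewrite ltn_sorted_uniq_leq sort_uniq fset_uniq sort_sorted //; exact: leq_total.
Qed.

Lemma fs_sort E : fs (sort leq E) = E.
Proof. by apply/fsetP => i; rewrite mem_fs mem_sort. Qed.

Lemma perm_fs s : sorted ltn s -> perm_eq (fs s) s.
Proof.
move=> ss; apply: uniq_perm; rewrite ?fset_uniq //.
  by move: ss; rewrite ltn_sorted_uniq_leq => /andP[].
by move=> i; rewrite mem_fs.
Qed.

Lemma eq_sorted_ltn s t : sorted ltn s -> sorted ltn t -> s =i t -> s = t.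
Proof. exact: (irr_sorted_eq ltn_trans ltnn). Qed.

Lemma sort_fs s : sorted ltn s -> sort leq (fs s) = s.
Proof.
move=> ss; apply: eq_sorted_ltn ss _; first exact: sort_fset_sorted.
by move=> i; rewrite mem_sort mem_fs.
Qed.

Lemma fmin_fs s : sorted ltn s -> fmin (fs s) = head 0%N s.
Proof. by move=> ss; rewrite /fmin sort_fs. Qed.

Lemma card_fs s : sorted ltn s -> #|` fs s| = size s.
Proof. by move=> ss; exact: perm_size (perm_fs ss). Qed.

Lemma fs_eq0 s : (fs s == fset0) = (s == [::]).
Proof.
apply/eqP/eqP => [|->]; last by apply/fsetP => i; rewrite !inE.
by case: s => // i s /fsetP/(_ i); rewrite mem_fs mem_head.
Qed.

Lemma before_fs s t : before (fs s) (fs t) = all (fun i => all (ltn i) t) s.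
Proof.
rewrite /before (eq_all_r (mem_fs s)); apply: eq_all => i.
exact: (eq_all_r (mem_fs t)).
Qed.

End FsetSeq.

Lemma sorted_ltn_cat (s t : seq nat) :
  sorted ltn (s ++ t) =
  [&& sorted ltn s, sorted ltn t & all (fun i => all (ltn i) t) s].
Proof.
rewrite !(sorted_pairwise ltn_trans) pairwise_cat.
rewrite /allrel; case: (all _ s); case: (pairwise _ s); by case: (pairwise _ t).
Qed.

Lemma sorted_ltn_map (f : nat -> nat) (s : seq nat) :
  {homo f : i j / (i < j)%N} -> sorted ltn s -> sorted ltn (map f s).
Proof. by move=> f_incr; apply: homo_sorted. Qed.

Lemma incr_ge (f : nat -> nat) : {homo f : i j / (i < j)%N} ->
  forall i, (i <= f i)%N.
Proof. by move=> fi; elim=> // i IH; apply: leq_ltn_trans IH (fi _ _ _). Qed.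

Lemma incr_step (f : nat -> nat) : (forall i, (f i < f i.+1)%N) ->
  {homo f : i j / (i < j)%N}.
Proof. by move=> fS; apply: homo_ltn => // i j k; apply: ltn_trans. Qed.

Lemma heads_sorted (ss : seq (seq nat)) : (forall t, t \in ss -> t != [::]) ->
  sorted ltn (flatten ss) -> sorted ltn (map (head 0%N) ss).
Proof.
elim: ss => // t ss IH ne /=; rewrite sorted_ltn_cat => /and3P[_ sss tss].
rewrite (path_sortedE ltn_trans) IH ?andbT //; last first.
  by move=> u uss; apply: ne; rewrite inE uss orbT.
apply/allP => _ /mapP[u uss ->].
case: t ne tss => [/(_ _ (mem_head _ _))//|i t ne /= /andP[/allP + _]]; apply.
have := ne u; rewrite inE uss orbT => /(_ isT).
by case: u uss => // j u uss _; apply/flattenP; exists (j :: u); rewrite // mem_head.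
Qed.

Lemma head_flatten (ss : seq (seq nat)) : (forall t, t \in ss -> t != [::]) ->
  head 0%N (flatten ss) = head 0%N (map (head 0%N) ss).
Proof. by case: ss => // -[|i t] ss // /(_ [::] (mem_head _ _)). Qed.

Definition listed (F : set {fset nat}) : set (seq nat) :=
  [set s | sorted ltn s /\ F (fs s)].

(** [seq_comp F G] is F[G] on increasing sequences: cutting a sequence in
    consecutive pieces makes the condition E_1 < ... < E_n automatic. *)
Definition seq_comp (F G : set (seq nat)) : set (seq nat) :=
  [set s | sorted ltn s /\ exists ss,
     [/\ s = flatten ss, F (map (head 0%N) ss)
       & forall t, t \in ss -> t != [::] /\ G t]].

Lemma flatten_sorted (ss : seq (seq nat)) (t : seq nat) :
  sorted ltn (flatten ss) -> t \in ss -> sorted ltn t.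
Proof.
elim: ss => // u ss IH /=; rewrite sorted_ltn_cat inE => /and3P[su sss _].
by case/orP=> [/eqP->//|]; apply: IH.
Qed.

Lemma listed_comp F G : listed (schreier_comp F G) = seq_comp (listed F) (listed G).
Proof.
apply/seteqP; split=> s [ss].
  move=> [Es [sE bE FE GE]]; split=> //.
  exists (map (fun A : {fset nat} => sort leq A) Es).
  have sfl : sorted ltn (flatten (map (fun A : {fset nat} => sort leq A) Es)).
    elim: Es bE {sE FE GE} => // A Es IH /= /andP[/allP bA bE].
    rewrite sorted_ltn_cat sort_fset_sorted IH //=.
    apply/allP => i; rewrite mem_sort => iA; apply/allP => j /flattenP[_ /mapP[B BE ->]].
    by rewrite mem_sort => jB; move: (bA _ BE) => /allP/(_ _ iA)/allP/(_ _ jB).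
  have ne t : t \in [seq sort leq A | A : {fset nat} <- Es] -> t != [::].
    move=> /mapP[A AE ->]; have [+ _] := GE _ AE; apply: contra => /eqP A0.
    by rewrite -(fs_sort A) A0; apply/eqP/fsetP => i; rewrite mem_fs.
  split.
  - apply: eq_sorted_ltn => // i; rewrite -mem_fs sE.
    apply/bigfcupP/flattenP => [[A /andP[AE _] iA]|[_ /mapP[A AE ->]]].
      by exists (sort leq A); rewrite ?mem_sort //; apply/mapP; exists A.
    by rewrite mem_sort => iA; exists A; rewrite // AE.
  - split; first exact: heads_sorted.
    by rewrite -map_comp; rewrite (_ : map _ Es = map fmin Es).
  - move=> t tE; split; first exact: ne.
    move: tE => /mapP[A AE ->]; split; first exact: sort_fset_sorted.
    by rewrite fs_sort; case: (GE _ AE).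
move=> [ts [sE [_ Fh] Gt]]; split=> //; exists (map (fun t => fs t) ts); split.
- apply/fsetP => i; rewrite mem_fs sE; apply/flattenP/bigfcupP.
    move=> [t tts it]; exists (fs t); last by rewrite mem_fs.
    by rewrite andbT; apply/mapP; exists t.
  move=> [_ /andP[/mapP[t tts ->] _]]; rewrite mem_fs => it.
  by exists t.
- move: ss; rewrite sE; elim: ts {sE Fh Gt} => // t ts IH /=.
  rewrite sorted_ltn_cat => /and3P[_ sts /allP tts]; rewrite IH // andbT.
  apply/allP => _ /mapP[u uts ->]; rewrite before_fs.
  apply/allP => i it; apply/allP => j ju; move: (tts _ it) => /allP; apply.
  by apply/flattenP; exists u.
- rewrite -map_comp (_ : map _ ts = map (head 0%N) ts) //.
  apply/eq_in_map => t tts /=; apply: fmin_fs.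
  by apply: (@flatten_sorted ts) => //; rewrite -sE.
- move=> _ /mapP[t tts ->]; rewrite fs_eq0.
  by have [tn [_ Gs]] := Gt _ tts.
Qed.

(** The usual spreading property, for pushes to the right that are induced by
    a map of N. *)
Definition spreading (F : set (seq nat)) : Prop :=
  forall f : nat -> nat, {homo f : i j / (i < j)%N} ->
  forall s, F s -> F (map f s).

Lemma seq_comp_map F G G' (f : nat -> nat) : {homo f : i j / (i < j)%N} ->
  spreading F -> (forall s, G s -> G' (map f s)) ->
  forall s, seq_comp F G s -> seq_comp F G' (map f s).
Proof.
move=> f_incr spF GG s [ss [ts [sE Fh Gt]]]; split; first exact: sorted_ltn_map.
exists (map (map f) ts); split.
- by rewrite sE map_flatten.
- rewrite (_ : map _ _ = map f (map (head 0%N) ts)); first exact: spF.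
  rewrite -!map_comp; apply/eq_in_map => t /Gt[].
  by case: t.
- move=> _ /mapP[t tts ->]; have [tn tG] := Gt _ tts.
  by split; [case: t tn {tts tG} | apply: GG].
Qed.

Lemma seq_comp_spreading F G : spreading F -> spreading G -> spreading (seq_comp F G).
Proof. by move=> spF spG f f_incr; apply: seq_comp_map => //; exact: spG. Qed.

Lemma flatten_map_flatten (T : Type) (vs : seq (seq (seq T))) :
  flatten (map flatten vs) = flatten (flatten vs).
Proof. by elim: vs => //= v vs ->; rewrite flatten_cat. Qed.

(** Composition of families is associative in one direction: the pieces are
    grouped according to the outer decomposition of the set of their minima. *)
Lemma seq_comp_assoc F G H :
  seq_comp (seq_comp F G) H `<=` seq_comp F (seq_comp G H).
Proof.
move=> s [ss [ts [sE [hs [us [hE Fu Gu]]] Ht]]]; split=> //.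
have tn t : t \in ts -> t != [::] by move=> /Ht[].
suff [vs [vE vS]] : exists vs : seq (seq (seq nat)),
    flatten vs = ts /\ map (map (head 0%N)) vs = us.
  exists (map flatten vs); split.
  - by rewrite sE -vE flatten_map_flatten.
  - rewrite (_ : map _ _ = map (head 0%N) us) // -vS -!map_comp.
    apply/eq_in_map => v vvs /=; apply: head_flatten => t tv; apply: tn.
    by rewrite -vE; apply/flattenP; exists v.
  - move=> _ /mapP[v vvs ->].
    have [vn vG] : map (head 0%N) v != [::] /\ G (map (head 0%N) v).
      by apply: Gu; rewrite -vS map_f.
    have vts t : t \in v -> t \in ts by move=> tv; rewrite -vE; apply/flattenP; exists v.
    split.
      case: v vvs vn vG vts => // t v vvs _ _ vts /=.
      by have := tn t (vts _ (mem_head _ _)); case: t {vvs vts}.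
    split; last by exists v; split=> // t /vts/Ht.
    apply: (@flatten_sorted (map flatten vs)); last exact: map_f.
    by rewrite flatten_map_flatten vE -sE.
elim: us ts hE {sE hs Fu Gu Ht tn} => [|u us IH] ts /= hE.
  by exists [::]; case: ts hE.
have [|vs [vE vS]] := IH (drop (size u) ts).
  by rewrite map_drop hE drop_size_cat.
exists (take (size u) ts :: vs); rewrite /= vE cat_take_drop; split=> //.
by rewrite map_take hE take_size_cat // vS.
Qed.

Section Schreier.
Variables (d : Order.disp_t) (W : orderType d).
Hypothesis hW : is_omega1 W.
Variable S : W -> set {fset nat}.
Hypothesis hS : schreier_families S.

Local Notation Sq a := (listed (S a)).

Lemma Sq_zero z s : ord_zero z ->
  Sq z s <-> s = [::] \/ exists2 n, (0 < n)%N & s = [:: n].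
Proof.
case: hS => S0 _ _ /S0 Sz; rewrite /listed /= Sz; split.
  move=> [ss [/eqP|[n n0 sE]]]; first by rewrite fs_eq0 => /eqP; left.
  right; exists n => //; apply: eq_sorted_ltn => // i.
  by rewrite -mem_fs sE !inE.
case=> [->|[n n0 ->]]; split => //; rewrite /schreier0 /=; [left|right].
  by apply/eqP; rewrite fs_eq0.
by exists n => //; apply/fsetP => i; rewrite mem_fs !inE.
Qed.

Lemma listed_schreier1 s : sorted ltn s ->
  listed schreier1 s <-> (size s <= head 0%N s)%N.
Proof.
move=> ss; rewrite /listed /schreier1 /= card_fs // fmin_fs //; split=> [|le].
  by case=> _ [/eqP|//]; rewrite fs_eq0 => /eqP ->.
by split=> //; right.
Qed.

Lemma Sq_succ a b : ord_succ a b -> Sq b = seq_comp (listed schreier1) (Sq a).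
Proof. by case: hS => _ S1 _ /S1 ->; rewrite listed_comp. Qed.

Lemma Sq_succP a b s : ord_succ a b -> Sq b s <-> sorted ltn s /\ exists ss,
  [/\ s = flatten ss, forall t, t \in ss -> t != [::] /\ Sq a t
    & (size ss <= head 0%N s)%N].
Proof.
move=> ab; rewrite (Sq_succ ab); split=> -[ss [ts [sE]]].
  move=> h1 St; split=> //; exists ts; split=> //.
  rewrite sE head_flatten; last by move=> t /St[].
  by have := listed_schreier1 (proj1 h1) => -[/(_ h1)]; rewrite size_map.
move=> St le; have tn t : t \in ts -> t != [::] by move=> /St[].
split=> //; exists ts; split=> //; apply/listed_schreier1.
  by apply: heads_sorted => //; rewrite -sE.
by rewrite size_map -head_flatten // -sE.
Qed.

Lemma Sq_limit l : ord_limit l -> exists xs : nat -> W,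
  [/\ forall n, (xs n < l)%O,
      supremums (range xs) l,
      forall m n, (m <= n)%N -> Sq (xs m) `<=` Sq (xs n)
    & forall s, Sq l s <-> sorted ltn s /\
        (s = [::] \/ exists2 n, all (ltn n) s & Sq (xs n) s)].
Proof.
case: hS => _ _ /[apply] -[xs [_ xs_incr xsl Sxs Sl]]; exists xs; split=> //.
  move=> n; apply: lt_le_trans (xs_incr n) _.
  by have [+ _] := xsl; apply; exists n.+1.
  move=> m n mn s [ss h]; split=> //; move: mn h.
  elim: n => [|n IH]; first by rewrite leqn0 => /eqP->.
  by rewrite leq_eqVlt => /orP[/eqP->//|/IH{}IH /IH]; apply: Sxs.
move=> s; rewrite /listed /= Sl /=; split=> -[ss].
  move=> h; split=> //; case: h => [/eqP|[n [nE Sn]]]; first by rewrite fs_eq0 => /eqP; left.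
  right; exists n => //; apply/allP => i is_; apply: nE.
  by rewrite mem_fs.
case=> [->|[n /allP nE [_ Sn]]]; split=> //.
  by left; apply/eqP; rewrite fs_eq0.
by right; exists n; split=> // i; rewrite mem_fs => /nE.
Qed.

Lemma Sq_sorted a s : Sq a s -> sorted ltn s.
Proof. by case. Qed.

Lemma Sq_nil a : Sq a [::].
Proof.
case: (ord_cases a) => [a0|[b /Sq_succP->]|/Sq_limit[xs [_ _ _ ->]]].
- by apply/Sq_zero => //; left.
- by split=> //; exists [::].
- by split=> //; left.
Qed.

Lemma Sq_one a n : (0 < n)%N -> Sq a [:: n].
Proof.
move=> n0; elim/(ord_ind hW): a => a IH.
case: (ord_cases a) => [a0|[b ba]|al].
- by apply/Sq_zero => //; right; exists n.
- apply/(Sq_succP _ ba); split=> //; exists [:: [:: n]]; split=> //= t.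
  by rewrite inE => /eqP->; split=> //; apply: IH; case: ba.
- have [xs [xsl _ _ ->]] := Sq_limit al.
  by split=> //; right; exists 0%N => /=; [rewrite n0 | apply: IH].
Qed.

Lemma Sq_pos a s : Sq a s -> all (ltn 0) s.
Proof.
elim/(ord_ind hW): a s => a IH s.
case: (ord_cases a) => [/Sq_zero->|[b ba]|/Sq_limit[xs [xsl _ _ ->]]].
- by case=> [->|[n n0 ->]] //=; rewrite n0.
- move=> /(Sq_succP _ ba)[_ [ts [-> St _]]].
  apply/allP => i /flattenP[t /St[_ /IH]]; case: ba => ba _ /(_ ba) /allP.
  exact.
- by case=> _ [->|[n _ /IH]] //; apply.
Qed.

Lemma schreier1_spreading : spreading (listed schreier1).
Proof.
move=> f f_incr s [ss]; have fs_ := sorted_ltn_map f_incr ss.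
move=> h; apply/listed_schreier1 => //; rewrite size_map.
have /(listed_schreier1 ss) : listed schreier1 s by [].
by case: s {ss fs_ h} => //= i s le; apply: leq_trans le (incr_ge f_incr i).
Qed.

Lemma Sq_spreading a : spreading (Sq a).
Proof.
elim/(ord_ind hW): a => a IH.
case: (ord_cases a) => [a0|[b ba]|/Sq_limit[xs [xsl _ _ Sl]]].
- move=> f f_incr s /(Sq_zero _ a0) h; apply/Sq_zero => //.
  case: h => [->|[n n0 ->]]; [by left|right; exists (f n) => //].
  exact: leq_trans n0 (incr_ge f_incr n).
- rewrite (Sq_succ ba); apply: seq_comp_spreading; first exact: schreier1_spreading.
  by apply: IH; case: ba.
- move=> f f_incr s /Sl[ss h]; apply/Sl; split; first exact: sorted_ltn_map.
  case: h => [->|[n /allP ns Ss]]; [by left|right; exists n].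
    apply/allP => _ /mapP[i is_ ->]; apply: leq_trans (incr_ge f_incr i).
    exact: ns.
  exact: IH.
Qed.

Lemma Sq_succ_sub a b : ord_succ a b -> Sq a `<=` Sq b.
Proof.
move=> ab [|i s] Ss; first exact: Sq_nil.
apply/(Sq_succP _ ab); split; first exact: Sq_sorted Ss.
exists [:: i :: s]; split; rewrite /= ?cats0 //.
  by move=> t; rewrite inE => /eqP->.
by have /andP[] := Sq_pos Ss.
Qed.

(** The families increase with the ordinal only up to finitely many
    positions, because of the choices made at limit ordinals. *)
Lemma Sq_tail a b : (a < b)%O ->
  exists k, forall s, Sq a s -> all (ltn k) s -> Sq b s.
Proof.
elim/(ord_ind hW): b => b IH ab.
case: (ord_cases b) => [b0|[c cb]|/Sq_limit[xs [xsl xsup _ Sl]]].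
- by have := ord_lt_pos ab.
- have := ord_succ_leP cb ab; rewrite le_eqVlt => /orP[/eqP->|ac].
    by exists 0%N => s Ss _; apply: (Sq_succ_sub cb).
  have [k kP] := IH c (proj1 cb) ac; exists k => s Ss ks.
  by apply: (Sq_succ_sub cb); apply: kP.
- have [_ [n _ <-] an] := lt_supremums xsup ab.
  have [k kP] := IH _ (xsl n) an; exists (maxn k n) => s Ss /allP ks.
  apply/Sl; split; first exact: Sq_sorted Ss.
  right; exists n.
    by apply/allP => i /ks /=; apply: leq_ltn_trans; exact: leq_maxr.
  apply: kP => //; apply/allP => i /ks /=; apply: leq_ltn_trans; exact: leq_maxl.
Qed.

(** Below [b] there is room for any fixed number of consecutive members of
    S_a, once they are pushed far enough. *)
Lemma Sq_blocks a b N : (a < b)%O -> exists k, forall ts,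
  (size ts <= N)%N -> (forall t, t \in ts -> Sq a t) -> sorted ltn (flatten ts) ->
  all (ltn k) (flatten ts) -> Sq b (flatten ts).
Proof.
move=> ab; have [c ac cb] := ord_succ_le hW ab.
have [k kP] : exists k, forall s, Sq c s -> all (ltn k) s -> Sq b s.
  move: cb; rewrite le_eqVlt => /orP[/eqP->|/Sq_tail//].
  by exists 0%N.
exists (maxn k N) => ts sts St so /allP all_k.
apply: kP; last first.
  by apply/allP => i /all_k /=; apply: leq_ltn_trans; exact: leq_maxl.
have flE : flatten ts = flatten [seq t <- ts | t != [::]].
  by elim: (ts) => //= -[|i t] us -> //.
case E : (flatten ts) => [|i s]; first exact: Sq_nil.
apply/(Sq_succP _ ac); rewrite -E; split=> //.
exists [seq t <- ts | t != [::]]; split=> //.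
  by move=> t; rewrite mem_filter => /andP[? /St].
rewrite E /=; apply: leq_trans (_ : N <= _)%N.
  by apply: leq_trans sts; rewrite size_filter; exact: count_size.
apply: leq_trans (leq_maxr k N) _; apply: ltnW; apply: all_k.
by rewrite E mem_head.
Qed.

Lemma Sq_short b N : ~ ord_zero b -> exists k, forall s,
  (size s <= N)%N -> sorted ltn s -> all (ltn k) s -> Sq b s.
Proof.
move=> b0; have [z z0] := ord_zero_ex hW.
have [k kP] := Sq_blocks N (ord_pos_lt z0 b0); exists k => s sN ss ks.
have flE : s = flatten [seq [:: i] | i <- s] by rewrite flatten_seq1.
rewrite flE; apply: kP; rewrite -?flE ?size_map // => _ /mapP[i is_ ->].
by apply: Sq_one; apply: leq_ltn_trans (leq0n k) _; move/allP: ks => /(_ _ is_).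
Qed.

Section Composition.
Variable add : W -> W -> W.
Hypothesis addP : ord_addition add.

(** S_b[S_a] sits in S_(a + b) along a subsequence of N.  At a limit [b] the
    subsequences [M n] obtained below [b] are combined into the diagonal of
    the compositions M 0 o ... o M n: composing on either side is harmless
    since all families are spreading. *)
Lemma Sq_comp_sub a b : exists M : nat -> nat, {homo M : i j / (i < j)%N} /\
  forall s, seq_comp (Sq b) (Sq a) s -> Sq (add a b) (map M s).
Proof.
elim/(ord_ind hW): b => b IH; have [add0 addS addl] := addP a.
case: (ord_cases b) => [b0|[c cb]|bl].
- exists id; split=> // s [ss [ts [sE]]]; rewrite add0 // map_id.
  rewrite sE => /(Sq_zero _ b0); case: ts {ss sE} => [|t [|u ts]] /=.
  + by move=> _ _; exact: Sq_nil.
  + by rewrite cats0 => _ /(_ _ (mem_head _ _))[].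
  + by case=> // -[].
- have [M [M_incr MP]] := IH c (proj1 cb); exists M; split=> // s.
  rewrite (Sq_succ cb) (Sq_succ (addS _ _ cb)) => /seq_comp_assoc.
  by apply: seq_comp_map => //; exact: schreier1_spreading.
have [xs [xsl _ _ Sl]] := Sq_limit bl.
have /choice[M0 M0P] n := IH _ (xsl n).
have /choice[k kP] n := Sq_tail (add_lt2 hW addP a (xsl n)).
pose M n i := ((k n).+1 + M0 n i)%N.
have M_incr n : {homo M n : i j / (i < j)%N}.
  by move=> i j ij; rewrite /M ltn_add2l; apply: (proj1 (M0P n)).
have MP n s : seq_comp (Sq (xs n)) (Sq a) s -> Sq (add a b) (map (M n) s).
  move=> Rs; apply: (kP n).
    rewrite (_ : map (M n) s = map (addn (k n).+1) (map (M0 n) s)).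
      apply: Sq_spreading; first by move=> i j; rewrite ltn_add2l.
      by have [_] := M0P n; apply.
    by rewrite -map_comp.
  by apply/allP => _ /mapP[i _ ->]; rewrite /M /= ltnS; exact: leq_addr.
pose K := fix K n := if n is n'.+1 then K n' \o M n else M 0%N.
pose G := fix G n j := if j is j'.+1 then G n j' \o M (n + j)%N else id.
have K_incr n : {homo K n : i j / (i < j)%N}.
  by elim: n => [|n IHn] i j ij /=; [exact: M_incr | apply: IHn; exact: M_incr].
have G_incr n m : {homo G n m : i j / (i < j)%N}.
  by elim: m => [|m IHm] i j ij //=; apply: IHm; exact: M_incr.
have KG n j i : K (n + j)%N i = K n (G n j i).
  elim: j i => [|j IHj] i /=; first by rewrite addn0.
  by rewrite addnS /= IHj.
have KP n : exists2 P, {homo P : i j / (i < j)%N} & K n = P \o M n.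
  case: n => [|n]; last by exists (K n).
  by exists id.
exists (fun i => K i i); split.
  apply: incr_step => i /=; apply: K_incr.
  exact: leq_trans (ltnSn i) (incr_ge (M_incr _) _).
move=> s [ss [ts [sE /Sl[_ hts] Sts]]].
case: hts => [h0|[n nts Sn]].
  suff -> : s = [::] by exact: Sq_nil.
  by rewrite sE; case: ts h0 {sE Sts}.
have ns : all (ltn n) s.
  case: s ss sE => // i s ss sE.
  have ni : (n < i)%N.
    move/allP: nts; apply; rewrite (_ : i = head 0%N (i :: s)) // sE head_flatten.
      by case: ts sE {Sts Sn} => //= t ts _; exact: mem_head.
    by move=> t /Sts[].
  rewrite /= ni; move: ss => /= /(order_path_min ltn_trans)/allP si.
  by apply/allP => j /si; exact: ltn_trans.
have [P P_incr PE] := KP n.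
(* Beyond [n] the diagonal map factors as P o M n o g with g increasing. *)
pose g i := if (i < n)%N then i else G n (i - n)%N i.
have g_incr : {homo g : i j / (i < j)%N}.
  apply: incr_step => i; rewrite /g; case: (ltnP i n) => ni.
    by case: ifP => // _; apply: leq_trans (ltnSn i) (incr_ge (G_incr _ _) _).
  have -> : (i.+1 < n)%N = false by lia.
  rewrite subSn //=; apply: G_incr.
  exact: leq_trans (ltnSn i) (incr_ge (M_incr _) _).
rewrite (_ : map _ s = map P (map (M n) (map g s))).
  apply: Sq_spreading => //; apply: MP.
  apply: seq_comp_spreading; [exact: Sq_spreading|exact: Sq_spreading|by []|].
  by split=> //; exists ts.
rewrite -!map_comp; apply/eq_in_map => i /(allP ns) /= ni.
rewrite /g ltnNge (ltnW ni) /=.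
have := KG n (i - n)%N i; rewrite subnKC ?(ltnW ni) // => ->.
by rewrite PE.
Qed.

End Composition.

End Schreier.

(** * Large hereditary families *)

Section Large.
Variables (d : Order.disp_t) (W : orderType d).
Hypothesis hW : is_omega1 W.
Variable T : eqType.

(** An ultrafilter is used as a quantifier: [V P] means that [P p] holds for
    almost every [p]. *)
Variable V : set (set T).
Hypothesis V_mono : forall P Q : set T, P `<=` Q -> V P -> V Q.
Hypothesis V_or : forall P Q : set T, V (P `|` Q) -> V P \/ V Q.
Hypothesis V_ex : forall P : set T, V P -> exists p, P p.

Implicit Types (A B : set (seq T)) (st : seq W) (s t : seq T).

Definition hereditary A := forall s t, subseq s t -> A t -> A s.

Definition after A s : set (seq T) := [set t | A (s ++ t)].

Fixpoint iter_quant (Q : set (set (seq T))) (n : nat) A : Prop :=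
  if n is n'.+1 then Q [set s | iter_quant Q n' (after A s)] else A [::].

Lemma ord_wf : well_founded (fun a b : W => (a < b)%O).
Proof. by case: hW. Qed.

(** [large xi] is the ultrafilter-like quantifier on finite sequences that
    matches S_xi: [large 0] quantifies over one V-generic point, and for
    eta < xi any fixed number of successive [large eta] pieces is allowed.
    For hereditary [A] it expresses that, along V, the tree of
    [A] has rank at least omega ^ xi. *)
Definition large : W -> set (set (seq T)) :=
  Fix ord_wf (fun=> set (set (seq T)))
    (fun xi rec => [set A | V [set p | A [:: p]] /\
       forall eta (lt : (eta < xi)%O) n, iter_quant (rec eta lt) n A]).

Lemma largeE xi A : large xi A <-> V [set p | A [:: p]] /\
  forall eta, (eta < xi)%O -> forall n, iter_quant (large eta) n A.
Proof.
rewrite /large Fix_eq // => x f g fg; congr mkset; apply/funext => B.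
congr (_ /\ _); apply: eq_forall => eta; apply: eq_forall => lt.
by rewrite fg.
Qed.

Fixpoint larges st A : Prop :=
  if st is eta :: st' then large eta [set s | larges st' (after A s)]
  else A [::].

Lemma iter_quantE eta n A : iter_quant (large eta) n A = larges (nseq n eta) A.
Proof.
elim: n A => //= n IH A; congr (large _ _); apply/funext => s.
exact: IH.
Qed.

Lemma largeP xi A : large xi A <-> V [set p | A [:: p]] /\
  forall eta, (eta < xi)%O -> forall n, larges (nseq n eta) A.
Proof.
by rewrite largeE; split=> -[VA lA]; split=> // eta lt n;
  [rewrite -iter_quantE | rewrite iter_quantE]; apply: lA.
Qed.

Lemma after_nil A : after A [::] = A. Proof. by []. Qed.

Lemma after_cat A s t : after A (s ++ t) = after (after A s) t.
Proof. by apply/funext => u; rewrite /after /= catA. Qed.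

Lemma large_mono_of xi :
  (forall eta, (eta < xi)%O -> forall A B, A `<=` B -> large eta A -> large eta B) ->
  forall st, (forall eta, eta \in st -> (eta < xi)%O) ->
  forall A B, A `<=` B -> larges st A -> larges st B.
Proof.
move=> mono; elim=> [|eta st IH] lt A B AB /=; first exact: AB.
apply: mono => [|s]; first by apply: lt; rewrite mem_head.
apply: IH => [e est|t]; last exact: AB.
by apply: lt; rewrite inE est orbT.
Qed.

Lemma large_mono xi A B : A `<=` B -> large xi A -> large xi B.
Proof.
elim/(ord_ind hW): xi A B => xi IH A B AB /largeP[VA lA]; apply/largeP; split.
  by apply: V_mono VA => p; apply: AB.
move=> eta lt n; apply: large_mono_of IH _ _ _ _ AB (lA _ lt n) => e.
by rewrite mem_nseq => /andP[_ /eqP->].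
Qed.

Lemma larges_mono st A B : A `<=` B -> larges st A -> larges st B.
Proof.
elim: st A B => [|eta st IH] A B AB /=; first exact: AB.
by apply: large_mono => s; apply: IH => t; apply: AB.
Qed.

Lemma larges_cat st st' A :
  larges (st ++ st') A = larges st [set s | larges st' (after A s)].
Proof.
elim: st A => //= eta st IH A; congr (large _ _); apply/funext => s /=.
rewrite IH; congr (larges _ _); apply/funext => t /=.
by rewrite -after_cat.
Qed.

Lemma large_ex1 xi A : large xi A -> exists p, A [:: p].
Proof. by move=> /largeP[/V_ex[p Ap] _]; exists p. Qed.

Lemma large_ex xi A : large xi A -> exists s, A s.
Proof. by move=> /large_ex1[p Ap]; exists [:: p]. Qed.

Lemma large_zero z A : ord_zero z -> V [set p | A [:: p]] -> large z A.
Proof.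
by move=> z0 VA; apply/largeP; split=> // eta; rewrite ltNge z0.
Qed.

Lemma larges_ex st A : larges st A -> exists s, A s.
Proof.
elim: st A => [|eta st IH] A /=; first by exists [::].
by move=> /large_ex[s /IH[t]]; exists (s ++ t).
Qed.

Lemma large_le xi xi' A : (xi <= xi')%O -> large xi' A -> large xi A.
Proof.
move=> le /largeP[VA lA]; apply/largeP; split=> // eta lt; apply: lA.
exact: lt_le_trans le.
Qed.

Lemma larges_nseq_le n xi xi' A :
  (xi <= xi')%O -> larges (nseq n xi') A -> larges (nseq n xi) A.
Proof.
move=> le; elim: n A => //= n IH A /(large_le le).
by apply: large_mono => s; apply: IH.
Qed.

Lemma hereditary_after A s : hereditary A -> hereditary (after A s).
Proof. by move=> hA t u tu; apply: hA; rewrite cat_subseq. Qed.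

Lemma after_sub A s s' : hereditary A -> subseq s s' -> after A s' `<=` after A s.
Proof. by move=> hA ss' t; apply: hA; rewrite cat_subseq. Qed.

Lemma after_subl A s : hereditary A -> after A s `<=` A.
Proof. by move=> hA t; apply: hA; apply: suffix_subseq. Qed.

Lemma hereditary_larges st A : hereditary A ->
  hereditary [set s | larges st (after A s)].
Proof. by move=> hA s t ss'; apply: larges_mono; apply: after_sub. Qed.

Lemma hereditary_nil A s : hereditary A -> A s -> A [::].
Proof. by move=> hA; apply: hA; apply: sub0seq. Qed.

Lemma larges_behead eta st A : hereditary A -> larges (eta :: st) A -> larges st A.
Proof. by move=> hA /= /large_ex[s]; apply: larges_mono; apply: after_subl. Qed.

Lemma larges_nil st A : hereditary A -> larges st A -> A [::].
Proof. by move=> hA /larges_ex[s]; apply: hereditary_nil. Qed.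

Definition split_fam A B : set (seq T) :=
  [set s | exists m : bitseq,
    [/\ size m = size s, A (mask m s) & B (mask (map negb m) s)]].

Lemma subU_split_fam A B : hereditary A -> hereditary B -> B [::] -> A [::] ->
  A `|` B `<=` split_fam A B.
Proof.
move=> hA hB B0 A0 s [As|Bs].
  exists (nseq (size s) true); split; rewrite ?size_nseq ?mask_true //.
  by rewrite map_nseq mask_false.
exists (nseq (size s) false); split; rewrite ?size_nseq ?mask_false //.
by rewrite map_nseq mask_true.
Qed.

Lemma subseq_mask_split s t m : subseq s t -> size m = size t ->
  exists m', [/\ size m' = size s, subseq (mask m' s) (mask m t)
    & subseq (mask (map negb m') s) (mask (map negb m) t)].
Proof.
elim: t s m => [|y t IH] s m.
  by rewrite subseq0 => /eqP-> _; exists [::]; split; rewrite ?sub0seq.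
case: m => // b m; case: s => [|x s].
  by move=> _ _; exists [::]; split; rewrite // sub0seq.
case=> + [mt]; rewrite /=; case: (eqVneq x y) => [-> st|_ st].
  have [m' [m's sA sB]] := IH _ _ st mt; exists (b :: m'); split=> /=.
  - by rewrite m's.
  - by case: b => //=; rewrite eqxx.
  - by case: b => //=; rewrite eqxx.
have [m' [m's sA sB]] := IH _ _ st mt; exists m'; split=> //.
  by case: b => //=; apply: subseq_trans sA (subseq_cons _ _).
by case: b => //=; apply: subseq_trans sB (subseq_cons _ _).
Qed.

Lemma hereditary_split_fam A B : hereditary A -> hereditary B ->
  hereditary (split_fam A B).
Proof.
move=> hA hB s t st [m [mt Am Bm]].
have [m' [m's sA sB]] := subseq_mask_split st mt.
by exists m'; split=> //; [exact: hA sA Am | exact: hB sB Bm].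
Qed.

Section LargeSplit.
Variable eta : W.
Hypothesis large_split : forall A B, hereditary A -> hereditary B ->
  large eta (split_fam A B) -> large eta A \/ large eta B.

Lemma large_setU A B : hereditary A -> hereditary B ->
  large eta (A `|` B) -> large eta A \/ large eta B.
Proof.
move=> hA hB lAB; have [A0|A0] := pselect (A [::]); last first.
  right; apply: large_mono lAB => s [As|//].
  by case: A0; apply: hereditary_nil hA As.
have [B0|B0] := pselect (B [::]); last first.
  left; apply: large_mono lAB => s [//|Bs].
  by case: B0; apply: hereditary_nil hB Bs.
by apply: large_split => //; apply: large_mono lAB; apply: subU_split_fam.
Qed.

Lemma larges_setU n A B : hereditary A -> hereditary B ->
  larges (nseq n eta) (A `|` B) -> larges (nseq n eta) A \/ larges (nseq n eta) B.
Proof.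
elim: n A B => //= n IH A B hA hB lAB.
apply: large_setU; try exact: hereditary_larges.
by apply: large_mono lAB => s; apply: IH; apply: hereditary_after.
Qed.

Lemma larges_bigU n (I : eqType) (r : seq I) (F : I -> set (seq T)) :
  (forall i, hereditary (F i)) ->
  larges (nseq n eta) [set t | exists2 i, i \in r & F i t] ->
  exists2 i, i \in r & larges (nseq n eta) (F i).
Proof.
move=> hF; elim: r => [|i r IH] lF.
  by have [t [? //]] := larges_ex lF.
have hr : hereditary [set t | exists2 i, i \in r & F i t].
  by move=> s t st [j jr Fj]; exists j => //; apply: hF Fj.
have [|lFi|/IH[j jr lj]] := @larges_setU n _ _ (hF i) hr.
- apply: larges_mono lF => t [j]; rewrite inE => /orP[/eqP-> Fi|jr Fj]; first by left.
  by right; exists j.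
- by exists i => //; exact: mem_head.
- by exists j => //; rewrite inE jr orbT.
Qed.

(** Pigeonhole for iterated quantifiers: the first of the [n + m] pieces is
    split between [A] and [B] in one way only, up to a negligible set; what
    remains is then large after either part of that split. *)
Lemma larges_split n m A B : hereditary A -> hereditary B ->
  larges (nseq (n + m) eta) (split_fam A B) ->
  larges (nseq n eta) A \/ larges (nseq m eta) B.
Proof.
have [k] := ubnP (n + m); elim: k n m A B => // k IH n m A B.
rewrite ltnS => nmk hA hB lAB.
case: n => [|n] in nmk lAB *.
  left; have [s [b [_ As _]]] := larges_ex lAB.
  exact: hereditary_nil hA As.
case: m => [|m] in nmk lAB *.
  right; have [s [b [_ _ Bs]]] := larges_ex lAB.
  exact: hereditary_nil hB Bs.
apply: contrapT => /not_orP[nA nB].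
suff : large eta (split_fam [set s | larges (nseq n eta) (after A s)]
                            [set s | larges (nseq m eta) (after B s)]).
  by case/large_split; [exact: hereditary_larges|exact: hereditary_larges|exact: nA|exact: nB].
rewrite addSn /= in lAB; apply: large_mono lAB => s lAB.
have [||b bs lb] := @larges_bigU (n + m.+1) _ (map val (enum {: (size s).-tuple bool}))
  (fun b => split_fam (after A (mask b s)) (after B (mask (map negb b) s))).
- by move=> b; apply: hereditary_split_fam; apply: hereditary_after.
- apply: larges_mono lAB => t [b [bs Ab Bb]].
  exists (take (size s) b).
    have stb : size (take (size s) b) == size s.
      by rewrite size_take_min bs size_cat (minn_idPl _) // leq_addr.
    apply/mapP; exists (Tuple stb) => //.
    by rewrite mem_enum.
  exists (drop (size s) b); split; first by rewrite size_drop bs size_cat addKn.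
    rewrite /after /= -mask_cat ?cat_take_drop //.
    by rewrite size_take_min bs size_cat (minn_idPl _) // leq_addr.
  rewrite /after /= -mask_cat -?map_cat ?cat_take_drop // size_map.
  by rewrite size_take_min bs size_cat (minn_idPl _) // leq_addr.
have sb : size b = size s by case/mapP: bs => c _ ->; rewrite size_tuple.
have hAb := @hereditary_after A (mask b s) hA.
have hBb := @hereditary_after B (mask (map negb b) s) hB.
have subA : after A (mask b s) `<=` A by exact: after_subl.
have subB : after B (mask (map negb b) s) `<=` B.
  exact: after_subl.
exists b; split=> //.
  have nmk' : (n + m.+1 < k)%N by lia.
  by have [//|/(larges_mono subB)/nB] := IH n m.+1 _ _ nmk' hAb hBb lb.
have nmk' : (n.+1 + m < k)%N by lia.
rewrite addnS -addSn in lb.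
by have [/(larges_mono subA)/nA|] := IH n.+1 m _ _ nmk' hAb hBb lb.
Qed.

End LargeSplit.

Lemma not_large xi A : ~ large xi A ->
  ~ V [set p | A [:: p]] \/ exists eta n, (eta < xi)%O /\ ~ larges (nseq n eta) A.
Proof.
move=> nl; have [VA|] := pselect (V [set p | A [:: p]]); last by left.
right; apply: contrapT => no; apply: nl; apply/largeP; split=> // eta lt n.
by apply: contrapT => nA; apply: no; exists eta, n.
Qed.

Lemma not_large_base eta A : ~ V [set p | A [:: p]] -> ~ larges (nseq 1 eta) A.
Proof.
move=> nV /= /largeP[+ _]; apply: contra_not nV; exact: V_mono.
Qed.

(** Indecomposability of omega ^ xi: families that are not large fail already
    for finitely many pieces of one and the same smaller ordinal, and the
    numbers of pieces can be added. *)
Lemma large_split xi A B : hereditary A -> hereditary B ->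
  large xi (split_fam A B) -> large xi A \/ large xi B.
Proof.
elim/(ord_ind hW): xi A B => xi IH A B hA hB lAB; apply: contrapT => /not_orP[nA nB].
have clash eta n m : (eta < xi)%O -> ~ larges (nseq n eta) A ->
    ~ larges (nseq m eta) B -> False.
  move=> lt nAn nBm; have /largeP[_ /(_ _ lt (n + m)%N)] := lAB.
  by move=> /(larges_split (IH _ lt) hA hB)[].
case: (not_large nA) (not_large nB) => [VA|[e [n [ex An]]]] [VB|[e' [m [e'x Bm]]]].
- have /largeP[VAB _] := lAB.
  have /V_or[//|//] : V ([set p | A [:: p]] `|` [set p | B [:: p]]).
  by apply: V_mono VAB => p [[|[] [|? ?]] [//= _ ? ?]]; [left|right].
- exact: clash e'x (not_large_base VA) Bm.
- exact: clash ex An (not_large_base VB).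
have [ee'|/ltW e'e] := leP e e'.
  by apply: (clash _ n _ e'x _ Bm) => /(larges_nseq_le ee')/An.
by apply: (clash _ _ m ex An) => /(larges_nseq_le e'e)/Bm.
Qed.

Definition colourable (I : eqType) (r : seq I) (F : I -> set (seq T)) : set (seq T) :=
  [set s : seq T | exists2 col : T -> I, forall p, p \in s -> col p \in r
     & forall i, F i [seq p <- s | col p == i]].

(** Indecomposability, used once per colour: the sequences are split between
    the first colour and the remaining ones. *)
Lemma large_colouring xi (I : eqType) (r : seq I) (F : I -> set (seq T)) :
  (forall i, hereditary (F i)) -> large xi (colourable r F) ->
  exists2 i, i \in r & large xi (F i).
Proof.
move=> hF; elim: r => [|i r IH] lF.
  by have [p [col /(_ p (mem_head _ _))]] := large_ex1 lF.
have hA : hereditary (colourable r F).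
  move=> s t st [col colr Fcol]; exists col => [p ps|j].
    by apply: colr; apply: (mem_subseq st).
  apply: hF (Fcol j); rewrite subseq_filter filter_all /=.
  exact: subseq_trans (filter_subseq _ _) st.
have [|lFi|lA] := @large_split xi _ _ (hF i) hA.
- apply: large_mono lF => s [col colr Fcol].
  exists [seq col p == i | p <- s]; rewrite size_map -filter_mask; split=> //.
  rewrite -map_comp -filter_mask; exists col => [p|j].
    by rewrite mem_filter /= => /andP[pi /colr]; rewrite inE (negPf pi).
  apply: hF (Fcol j); rewrite subseq_filter filter_all /=.
  exact: subseq_trans (filter_subseq _ _) (filter_subseq _ _).
- by exists i => //; exact: mem_head.
- by have [j jr lj] := IH lA; exists j => //; rewrite inE jr orbT.
Qed.

Section Stacks.
Variable S : W -> set {fset nat}.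
Hypothesis hS : schreier_families S.

Fixpoint stacked st (s : seq nat) : Prop :=
  if st is eta :: st' then exists s1 s2 : seq nat,
    [/\ s = s1 ++ s2, listed (S eta) s1 & stacked st' s2]
  else s = [::].

Lemma stacked_cat st st' (s s' : seq nat) :
  stacked st s -> stacked st' s' -> stacked (st ++ st') (s ++ s').
Proof.
elim: st s => [|eta st IH] s /=; first by move=> ->.
move=> [s1 [s2 [-> S1 S2]]] S'; exists s1, (s2 ++ s'); rewrite catA; split=> //.
exact: IH.
Qed.

Lemma stacked_nseq eta n ts : (size ts <= n)%N ->
  (forall t : seq nat, t \in ts -> listed (S eta) t) -> stacked (nseq n eta) (flatten ts).
Proof.
elim: n ts => [|n IH] [|t ts] //= len St.
  exists [::], [::]; split=> //; first exact: Sq_nil.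
  exact: (IH [::]).
exists t, (flatten ts); split=> //; first by apply: St; rewrite mem_head.
by apply: IH => // u uts; apply: St; rewrite inE uts orbT.
Qed.

(** A move of the game: when a member of S_eta starts with [m], its
    continuation lies in a stack [e] of smaller families, and [large eta] can
    accordingly be traded for one V-generic point followed by [larges e]. *)
Lemma large_move eta (m : nat) : exists e : seq W,
  (forall st A, larges (eta :: st) A ->
     V [set p | larges (e ++ st) (after A [:: p])]) /\
  forall s : seq nat, listed (S eta) (m :: s) -> stacked e s.
Proof.
elim/(ord_ind hW): eta => eta IH.
case: (ord_cases eta) => [e0|[b be]|el].
- exists [::]; split=> [st A /largeP[]//|s /(Sq_zero hS _ e0)[//|[n _ [_ ->]]//]].
- have [e [eV eS]] := IH b (proj1 be); exists (e ++ nseq m.-1 b); split.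
    move=> st A /largeP[_ /(_ b (proj1 be) m.-1.+1)] lA; rewrite -catA; apply: eV.
    by rewrite -cat_cons -[_ :: _]/(nseq m.-1.+1 b) larges_cat.
  move=> s /(Sq_succP hS _ be)[_ [ts [+ + /= len]]].
  case: ts len => [//|t ts] /= len sE St.
  have [tn St1] := St t (mem_head _ _).
  have {}St u : u \in ts -> listed (S b) u.
    by move=> uts; case: (St u) => //; rewrite inE uts orbT.
  case: t sE tn St1 => // i t [<- ->] _ St1.
  apply: stacked_cat; first exact: eS.
  by apply: stacked_nseq => //; case: (m) len.
- have [xs [xsl _ xs_mono Sl]] := Sq_limit hS el.
  have [e [eV eS]] := IH _ (xsl m.-1); exists e; split.
    move=> st A lA; apply: eV; exact: large_le (ltW (xsl _)) lA.
  move=> s /Sl[_ [//|[n /= /andP[nm _] Sn]]]; apply: eS; apply: xs_mono Sn.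
  by case: (m) nm.
Qed.

Lemma larges_move st (m : nat) : exists sts : seq (seq W),
  (forall A, hereditary A -> larges st A ->
     forall st', st' \in sts -> V [set p | larges st' (after A [:: p])]) /\
  forall s : seq nat, stacked st (m :: s) -> exists2 st', st' \in sts & stacked st' s.
Proof.
elim: st => [|eta st [sts [stsV stsS]]]; first by exists [::].
have [e [eV eS]] := large_move eta m; exists ((e ++ st) :: sts); split.
  move=> A hA lA st'; rewrite inE => /orP[/eqP->|]; first exact: eV.
  by apply: stsV => //; apply: larges_behead lA.
move=> s /= [[|i s1] [s2 [/= sE S1 S2]]].
  by have [|st' st's Ss] := stsS s; [rewrite sE|exists st'; rewrite // inE st's orbT].
exists (e ++ st); first exact: mem_head.
case: sE S1 => <- -> S1; apply: stacked_cat => //; exact: eS.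
Qed.

(** [matched F A]: the tree of [F] embeds in the tree of [A] along V, as
    witnessed by finitely many stacks. *)
Definition matched (F : set (seq nat)) A := exists sts : seq (seq W),
  (forall st, st \in sts -> larges st A) /\
  forall s : seq nat, F s -> exists2 st, st \in sts & stacked st s.

Lemma matched_listed eta A : large eta A -> hereditary A -> matched (listed (S eta)) A.
Proof.
move=> lA hA; exists [:: [:: eta]]; split=> [st|s Ss].
  rewrite inE => /eqP-> /=; apply: large_mono lA => s; rewrite /after /=.
  by rewrite cats0.
by exists [:: eta]; [exact: mem_head|exists s, [::]; rewrite cats0].
Qed.

Lemma matched_nil F A : hereditary A -> matched F A -> F [::] -> A [::].
Proof. by move=> hA [sts [lA stS]] /stS[st /lA lst _]; apply: larges_nil lst. Qed.

Lemma matched_move F A (m : nat) : hereditary A -> matched F A ->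
  exists sts : seq (seq W),
  (forall st, st \in sts -> V [set p | larges st (after A [:: p])]) /\
  forall s : seq nat, F (m :: s) -> exists2 st, st \in sts & stacked st s.
Proof.
move=> hA [sts [lA Fst]].
have /choice[nx nxP] st := larges_move st m.
exists (flatten (map nx sts)); split.
  move=> st' /flattenP[_ /mapP[st sts_st ->] st'nx].
  by have [+ _] := nxP st; apply=> //; apply: lA.
move=> s /Fst[st sts_st /(proj2 (nxP st))[st' st'nx Ss]]; exists st' => //.
by apply/flattenP; exists (nx st) => //; exact: map_f.
Qed.

End Stacks.

End Large.

(** * Extracting subsequences along a free ultrafilter *)

Lemma free_ultrafilter (I : set nat) : (forall k, exists2 n, I n & (k < n)%N) ->
  exists U : set (set nat),
    [/\ UltraFilter U, forall k, U [set n | (k < n)%N] & U I].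
Proof.
move=> Iinf.
pose F : set (set nat) := [set A | exists k, forall n, (k < n)%N -> I n -> A n].
have FF : ProperFilter F.
  split; first by case=> k Fk; have [n In /Fk] := Iinf k; apply.
  split.
  - by exists 0%N.
  - move=> A B [k kA] [l lB]; exists (maxn k l) => n.
    by rewrite gtn_max => /andP[kn ln] In; split; [apply: kA | apply: lB].
  - by move=> A B AB [k kA]; exists k => n kn In; apply: AB; apply: kA.
have [U [UU FU]] := ultraFilterLemma FF; exists U; split=> //.
- by move=> k; apply: FU; exists k.
- by apply: FU; exists 0%N.
Qed.

Section Subsequences.
Variable U : set (set nat).
Hypothesis UU : UltraFilter U.
Hypothesis U_free : forall k, U [set n | (k < n)%N].

Let UF : ProperFilter U. Proof. exact: ultra_proper. Qed.

Lemma ultra_mono (P Q : set nat) : P `<=` Q -> U P -> U Q.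
Proof. exact: filterS. Qed.

Lemma ultra_and (P Q : set nat) : U P -> U Q -> U (P `&` Q).
Proof. exact: filterI. Qed.

Lemma ultra_or (P Q : set nat) : U (P `|` Q) -> U P \/ U Q.
Proof.
move=> UPQ; have [|UnP] := in_ultra_setVsetC P UU; first by left.
right; apply: filterS (filterI UPQ UnP) => n [[]//].
Qed.

Lemma ultra_ex (P : set nat) : U P -> exists n, P n.
Proof. by move=> /filter_ex. Qed.

Lemma ultra_all (I : eqType) (r : seq I) (P : I -> set nat) :
  (forall i, i \in r -> U (P i)) -> U [set n | forall i, i \in r -> P i n].
Proof.
elim: r => [|i r IH] UP; first by apply: filterS filterT.
have UPr : U [set n | forall j, j \in r -> P j n].
  by apply: IH => j jr; apply: UP; rewrite inE jr orbT.
apply: filterS (filterI (UP i (mem_head _ _)) UPr) => n [Pin Prn] j.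
by rewrite inE => /orP[/eqP->|/Prn].
Qed.

Lemma ultra_exists (I : eqType) (r : seq I) (P : I -> set nat) :
  U [set n | exists2 i, i \in r & P i n] -> exists2 i, i \in r & U (P i).
Proof.
elim: r => [|i r IH] UP; first by have [n []] := ultra_ex UP.
have /ultra_or[Ui|/IH[j jr Uj]] : U (P i `|` [set n | exists2 i, i \in r & P i n]).
- apply: filterS UP => n [j]; rewrite inE => /orP[/eqP->|jr Pj]; first by left.
  by right; exists j.
- by exists i => //; exact: mem_head.
- by exists j => //; rewrite inE jr orbT.
Qed.

Fixpoint signed_below (m : nat) : seq (seq (nat * bool)) :=
  if m is m'.+1 then
    signed_below m' ++ [seq rcons sg (m', b) | sg <- signed_below m', b <- [:: true; false]]
  else [:: [::]].

Lemma signed_belowS m sg :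
  reflect (sg \in signed_below m \/
           exists sg' b, sg' \in signed_below m /\ sg = rcons sg' (m, b))
          (sg \in signed_below m.+1).
Proof.
rewrite [signed_below m.+1]/(_ ++ _) mem_cat.
apply: (iffP orP) => -[h|h]; [by left| |by left|]; right.
  by case/allpairsPdep: h => sg' [b [sgm _ ->]]; exists sg', b.
case: h => sg' [b [sgm ->]]; apply/allpairsPdep; exists sg', b; split=> //.
by case: b.
Qed.

Lemma signed_belowP m sg : sorted ltn (unzip1 sg) -> all (gtn m) (unzip1 sg) ->
  sg \in signed_below m.
Proof.
elim: m sg => [|m IH] sg; first by case: sg.
case: (lastP sg) => [|{}sg [i b]] ssg lt.
  by apply/signed_belowS; left; apply: IH.
rewrite [unzip1 _]map_rcons in ssg lt *; apply/signed_belowS.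
have ssg' : sorted ltn (unzip1 sg).
  by move: ssg; rewrite -cats1 sorted_ltn_cat => /and3P[].
have ltsg : all (gtn i) (unzip1 sg).
  move: ssg; rewrite -cats1 sorted_ltn_cat => /and3P[_ _ /allP si].
  by apply/allP => j /si /=; rewrite andbT.
move: lt; rewrite all_rcons /= ltnS leq_eqVlt => /andP[/orP[/eqP im|im] _].
  rewrite im in ltsg *; right; exists sg, b; split=> //.
  exact: IH.
left; apply: IH; rewrite [unzip1 _]map_rcons; first exact: ssg.
rewrite all_rcons /= im /=; apply/allP => j /(allP ltsg) /= ji; exact: ltn_trans im.
Qed.

Lemma signed_below_lt m sg p : sg \in signed_below m -> p \in sg -> (p.1 < m)%N.
Proof.
elim: m sg => [|m IH] sg; first by rewrite inE => /eqP->.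
case/signed_belowS => [/IH h /h /ltnW//|[sg' [b [sg'm ->]]]].
by rewrite mem_rcons inE => /orP[/eqP->//|/(IH _ sg'm)/ltnW].
Qed.

(** Fusion. If [R F A] survives every move of [F], answered by almost every
    point with either sign, then a single subsequence answers all moves: at
    each stage only finitely many positions have been reached, so that one
    point suits them all. *)
Lemma fusion (R : set (seq nat) -> set (seq (nat * bool)) -> Prop) :
  (forall F A, hereditary A -> R F A -> F [::] -> A [::]) ->
  (forall F A m, hereditary A -> R F A ->
     U [set n | forall b, R (after F [:: m]) (after A [:: (n, b)])]) ->
  forall F A, hereditary A -> R F A ->
  exists2 l : nat -> nat, {homo l : i j / (i < j)%N} &
    forall s, sorted ltn s -> F s -> forall th : nat -> bool,
      A [seq (l i, th i) | i <- s].
Proof.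
move=> R0 Rmove F A hA RFA.
pose real (L : seq nat) (sg : seq (nat * bool)) := [seq (nth 0%N L p.1, p.2) | p <- sg].
pose inv L := forall sg, sg \in signed_below (size L) ->
  R (after F (unzip1 sg)) (after A (real L sg)).
have step L : exists n, inv L -> all (gtn n) L /\ inv (rcons L n).
  have [invL|] := pselect (inv L); last by exists 0%N.
  suff /ultra_ex[n Ln] : U [set n | all (gtn n) L /\ inv (rcons L n)] by exists n.
  have UL : U [set n | all (gtn n) L].
    have := ultra_all (fun i (_ : i \in L) => U_free i).
    by apply: filterS => n Ln; apply/allP.
  have /ultra_all Um : forall sg, sg \in signed_below (size L) ->
      U [set n | forall b, R (after F (rcons (unzip1 sg) (size L)))
                             (after A (rcons (real L sg) (n, b)))].
    move=> sg sgL; have := Rmove _ _ (size L) (hereditary_after hA) (invL _ sgL).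
    by apply: filterS => n Rn b; rewrite -!cats1 !after_cat.
  apply: filterS (filterI UL Um) => n [Ln mn]; split=> // sg.
  rewrite size_rcons => /signed_belowS[sgL|[sg' [b [sg'L ->]]]].
    rewrite (_ : real _ sg = real L sg); first exact: invL.
    apply/eq_in_map => p psg; rewrite nth_rcons.
    by rewrite (signed_below_lt sgL psg).
  rewrite /unzip1 /real !map_rcons /= nth_rcons ltnn eqxx.
  rewrite (_ : [seq _ | p <- sg'] = real L sg'); first exact: mn.
  apply/eq_in_map => p psg; rewrite nth_rcons.
  by rewrite (signed_below_lt sg'L psg).
have /choice[g gP] := step.
pose Ls m := iter m (fun L => rcons L (g L)) [::].
have sLs m : size (Ls m) = m by elim: m => //= m IH; rewrite size_rcons IH.
have invLs m : inv (Ls m).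
  elim: m => [|m IH /=]; last by have [] := gP _ IH.
  by move=> sg; rewrite /= inE => /eqP->; rewrite /= !after_nil.
pose l m := g (Ls m).
have nthLs k i : (i < k)%N -> nth 0%N (Ls k) i = l i.
  elim: k => // k IH; rewrite ltnS leq_eqVlt => /orP[/eqP->|ik] /=.
    by rewrite nth_rcons sLs ltnn eqxx.
  by rewrite nth_rcons sLs ik IH.
exists l.
  move=> i j ij; have [/allP + _] := gP _ (invLs j); apply.
  by rewrite -(nthLs j) //; apply: mem_nth; rewrite sLs.
move=> s ss Fs th.
have [m ltm] : exists m, forall i, i \in s -> (i < m)%N.
  by exists (\max_(i <- s) i).+1 => i is_; rewrite ltnS; exact: leq_bigmax_seq.
pose sg := [seq (i, th i) | i <- s].
have sgE : unzip1 sg = s by rewrite /unzip1 -map_comp map_id.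
have sgm : sg \in signed_below (size (Ls m)).
  rewrite sLs; apply: signed_belowP; rewrite sgE //.
  by apply/allP => i; apply: ltm.
have := R0 _ _ (hereditary_after hA) (invLs m _ sgm).
rewrite /after /= !cats0 sgE => /(_ Fs).
rewrite /real -map_comp (_ : map _ s = [seq (l i, th i) | i <- s]) //.
by apply/eq_in_map => i is_ /=; rewrite nthLs // ltm.
Qed.

Definition on_pairs : set (set (nat * nat)) :=
  [set P | U [set n | U [set n' | P (n, n')]]].

Lemma on_pairs_mono (P Q : set (nat * nat)) : P `<=` Q -> on_pairs P -> on_pairs Q.
Proof.
by move=> PQ; apply: (@ultra_mono) => n; apply: ultra_mono => n'; apply: PQ.
Qed.

Lemma on_pairs_or (P Q : set (nat * nat)) :
  on_pairs (P `|` Q) -> on_pairs P \/ on_pairs Q.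
Proof.
by move=> PQ; apply: ultra_or; apply: ultra_mono PQ => n UPQ; apply: ultra_or.
Qed.

Lemma on_pairs_ex (P : set (nat * nat)) : on_pairs P -> exists p, P p.
Proof. by move=> /ultra_ex[n /ultra_ex[n' Pnn']]; exists (n, n'). Qed.

Section LargeSchreier.
Variables (d : Order.disp_t) (W : orderType d).
Hypothesis hW : is_omega1 W.
Variable S : W -> set {fset nat}.
Hypothesis hS : schreier_families S.

Local Notation Sq a := (listed (S a)).
Local Notation largeU := (large hW U).
Local Notation largeV := (large hW on_pairs).

Definition flat (s : seq (nat * nat)) : seq nat := flatten [seq [:: p.1; p.2] | p <- s].

Definition signed_flat (s : seq (nat * nat)) : seq (nat * bool) :=
  flatten [seq [:: (p.1, true); (p.2, false)] | p <- s].

Lemma subseq_signed_flat s t : subseq s t -> subseq (signed_flat s) (signed_flat t).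
Proof.
elim: t s => [|y t IH] s; first by rewrite subseq0 => /eqP->.
case: s => [|x s]; first by rewrite sub0seq.
rewrite [subseq (x :: s) _]/=; case: eqP => [->|_] /IH st.
  by rewrite /signed_flat /= !eqxx.
exact: subseq_trans st (suffix_subseq [:: _; _] _).
Qed.

Lemma larges_Sq eta : (forall k, largeU eta [set s | Sq eta s /\ all (ltn k) s]) ->
  forall n k, larges hW U (nseq n eta)
    [set s | [/\ sorted ltn s, all (ltn k) s & exists ts,
       [/\ s = flatten ts, size ts = n & forall t, t \in ts -> Sq eta t]]].
Proof.
move=> lS; elim=> [|n IH] k /=; first by split=> //; exists [::].
apply: large_mono (lS k) => [P Q|s [Ss ks]]; first exact: ultra_mono.
apply: larges_mono (IH (maxn k (\max_(i <- s) i))) => [P Q|t]; first exact: ultra_mono.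
move=> [+ + [ts [tE sts Sts]]]; rewrite {}tE => sf /allP kf; split.
- rewrite sorted_ltn_cat sf (Sq_sorted Ss) /=.
  apply/allP => i is_; apply/allP => j /kf /=; rewrite gtn_max => /andP[_].
  by apply: leq_ltn_trans; exact: leq_bigmax_seq.
- rewrite all_cat ks; apply/allP => j /kf /=; rewrite gtn_max => /andP[].
  by [].
- exists (s :: ts); split=> //=; first by rewrite sts.
  by move=> u; rewrite inE => /orP[/eqP->//|/Sts].
Qed.

(** S_xi is large along every free ultrafilter: a fixed number of pieces from
    a smaller family lies in S_xi when the pieces start far enough. *)
Lemma large_Sq xi k : largeU xi [set s | Sq xi s /\ all (ltn k) s].
Proof.
elim/(ord_ind hW): xi k => xi IH k; apply/largeP; split.
  apply: ultra_mono (U_free k) => n /= kn; rewrite kn; split=> //.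
  by apply: (Sq_one hW) => //; apply: leq_ltn_trans kn.
move=> eta lt n; have [j jP] := Sq_blocks hW hS n lt.
apply: larges_mono (larges_Sq (IH _ lt) n (maxn k j)) => [P Q|s]; first exact: ultra_mono.
move=> [ss /allP ks [ts [sE sts Sts]]]; split.
  rewrite sE; apply: jP; rewrite -?sE ?sts //.
  by apply/allP => i /ks /=; rewrite gtn_max => /andP[].
by apply/allP => i /ks /=; rewrite gtn_max => /andP[].
Qed.

(** Passing from points to pairs costs nothing for xi > 0: two points are
    obtained by using [large 0] twice. *)
Lemma large_pairs xi A : ~ ord_zero xi -> largeU xi A -> largeV xi [set s | A (flat s)].
Proof.
have larges_flat eta :
    (forall A, largeU eta A -> largeV eta [set s | A (flat s)]) ->
    forall n A, larges hW U (nseq n eta) A ->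
      larges hW on_pairs (nseq n eta) [set s | A (flat s)].
  move=> lf; elim=> [|n IH] {}A //= /lf.
  apply: large_mono => [P Q|s /=]; first exact: on_pairs_mono.
  move=> /IH; apply: larges_mono => [P Q|t]; first exact: on_pairs_mono.
  by rewrite /after /= /flat map_cat flatten_cat.
have larges_flat0 z : ord_zero z -> forall n A, larges hW U (nseq (n + n) z) A ->
    larges hW on_pairs (nseq n z) [set s | A (flat s)].
  move=> z0; elim=> [|n IH] {}A //; rewrite addSn addnS /=.
  move=> /largeP[+ _] => UA; apply: large_zero => //.
  apply: ultra_mono UA => p /largeP[+ _]; apply: ultra_mono => q /=.
  move=> /IH; apply: larges_mono => [P Q|t]; first exact: on_pairs_mono.
  by rewrite /after.
elim/(ord_ind hW): xi A => xi IH A xi0 lA.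
have lflat eta n : (eta < xi)%O -> larges hW on_pairs (nseq n eta) [set s | A (flat s)].
  move=> lt; have /largeP[_ lAe] := lA.
  have [e0|e0] := pselect (ord_zero eta); first by apply: larges_flat0 => //; apply: lAe.
  by apply: larges_flat => [B|]; [apply: IH | apply: lAe].
apply/largeP; split; last by move=> eta lt n; apply: lflat.
have [z z0] := ord_zero_ex hW; have := lflat z 1%N (ord_pos_lt z0 xi0).
by move=> /= /largeP[+ _]; apply: ultra_mono => n; apply: ultra_mono.
Qed.

(** The signed form of the extraction: a family of signed sequences that is
    large for pairs (n, +), (n', -) admits all signs along a subsequence,
    because the sign asked for is met by one of the two points. *)
Lemma large_extract xi (A : set (seq (nat * bool))) : hereditary A ->
  largeV xi [set s | A (signed_flat s)] ->
  exists2 l : nat -> nat, {homo l : i j / (i < j)%N} &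
    forall s, Sq xi s -> forall th : nat -> bool, A [seq (l i, th i) | i <- s].
Proof.
pose Pr (A : set (seq (nat * bool))) : set (seq (nat * nat)) :=
  [set s | A (signed_flat s)].
have hPr B : hereditary B -> hereditary (Pr B).
  by move=> hB s t st; apply: hB; apply: subseq_signed_flat.
move=> hA lA.
pose R F B := matched hW on_pairs S F (Pr B).
have [| | |l l_incr lP] := @fusion R _ _ (Sq xi) A hA.
- move=> F B hB; apply: matched_nil; first exact: on_pairs_ex.
  exact: hPr.
- move=> F B m hB /(matched_move on_pairs_mono on_pairs_ex hS m (hPr _ hB))[sts [stsV stsF]].
  have Ub b : U [set n | forall st, st \in sts ->
      larges hW on_pairs st (Pr (after B [:: (n, b)]))].
    apply: ultra_all => st stst; have := stsV _ stst.
    case: b.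
      apply: ultra_mono => n /ultra_ex[n'].
      apply: larges_mono => [P Q|s]; first exact: on_pairs_mono.
      apply: hB => /=; rewrite !eqxx /=.
      exact: subseq_cons.
    move=> /ultra_ex[n]; apply: ultra_mono => n'.
    apply: larges_mono => [P Q|s]; first exact: on_pairs_mono.
    by apply: hB; exact: subseq_cons.
  apply: filterS (filterI (Ub true) (Ub false)) => n [nt nf] b.
  by exists sts; split=> //; case: b.
- by apply: matched_listed lA (hPr _ hA); exact: on_pairs_mono.
- by exists l => // s Ss; apply: lP => //; case: Ss.
Qed.

End LargeSchreier.
End Subsequences.

(** * Real and complex scalars treated alike *)

Section Scalars.
Variables (R : realType) (k : scalar_kind).
Local Notation K := (scalars R k).

Local Notation re := (@real_part R k).

Definition emb : R -> K :=
  match k return R -> scalars R k with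
  | RealScalars => fun r => r
  | ComplexScalars => fun r => (r%:C)%C
  end.

Definition im : K -> R :=
  match k return scalars R k -> R with
  | RealScalars => fun=> 0
  | ComplexScalars => fun c => complex.Im c
  end.

(** The imaginary unit, replaced by 0 over the reals, so that every scalar is
    [emb (re c) + iu * emb (im c)] in both cases. *)
Definition iu : K :=
  match k return scalars R k with
  | RealScalars => 0
  | ComplexScalars => ('i)%C
  end.

Definition absK (c : K) : R := re `|c|.

Lemma embK r : re (emb r) = r. Proof. by rewrite /emb; case: k. Qed.

Lemma re_add x y : re (x + y) = re x + re y.
Proof. by rewrite /real_part; case: k x y => //= -[? ?] [? ?]. Qed.

Lemma re_opp x : re (- x) = - re x.
Proof. by rewrite /real_part; case: k x => //= -[? ?]. Qed.

Lemma emb_add r s : emb (r + s) = emb r + emb s.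
Proof. by rewrite /emb; case: k => //; rewrite rmorphD. Qed.

Lemma emb_opp r : emb (- r) = - emb r.
Proof. by rewrite /emb; case: k => //; rewrite rmorphN. Qed.

Lemma emb_mul r s : emb (r * s) = emb r * emb s.
Proof. by rewrite /emb; case: k => //; rewrite rmorphM. Qed.

Lemma emb0 : emb 0 = 0. Proof. by rewrite /emb; case: k. Qed.

Lemma emb1 : emb 1 = 1. Proof. by rewrite /emb; case: k. Qed.

Lemma emb_le r s : (emb r <= emb s) = (r <= s).
Proof. by rewrite /emb; case: k => //; rewrite lecR. Qed.

Lemma emb_lt r s : (emb r < emb s) = (r < s).
Proof. by rewrite /emb; case: k => //; rewrite ltcR. Qed.

Lemma re_emb_mul r c : re (emb r * c) = r * re c.
Proof. by rewrite /real_part /emb; case: k c => //= -[a b] /=; ring. Qed.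

Lemma im_add x y : im (x + y) = im x + im y.
Proof. by rewrite /im; case: k x y => //= [_ _|[? ?] [? ?]//]; rewrite addr0. Qed.

Lemma im_emb_mul r c : im (emb r * c) = r * im c.
Proof. by rewrite /im /emb; case: k c => //= [_|[a b] /=]; ring. Qed.

Lemma scalarE c : c = emb (re c) + iu * emb (im c).
Proof.
rewrite /real_part /emb /iu /im; case: k c => [c|c]; first by rewrite mul0r addr0.
exact: complexE.
Qed.

Lemma iu_cases : iu = 0 \/ iu * iu = -1.
Proof.
rewrite /iu; case: k; [by left|right].
by rewrite -expr2; exact: sqr_i.
Qed.

Lemma re_iu_emb r : re (iu * emb r) = 0.
Proof.
rewrite /iu /emb /real_part; case: k; first by rewrite mul0r.
by rewrite mulrC ReiNIm /= oppr0.
Qed.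

Lemma re_iu_eq0 c : re (iu * c) = 0 -> c = emb (re c).
Proof.
rewrite /iu /emb /real_part; case: k c => // c.
rewrite mulrC ReiNIm => /eqP; rewrite oppr_eq0 => /eqP c0.
by case: c c0 => a b /= ->.
Qed.

Lemma ge0_embK (x : K) : 0 <= x -> emb (re x) = x.
Proof.
rewrite /real_part /emb; case: k x => // x x0; apply: RRe_real; exact: ger0_real.
Qed.

Lemma re_le (x y : K) : x <= y -> re x <= re y.
Proof. by rewrite /real_part; case: k x y => // x y; rewrite lecE => /andP[]. Qed.

Lemma re_ge0 (x : K) : 0 <= x -> 0 <= re x.
Proof. by move=> /re_le; rewrite -{1}emb0 embK. Qed.

Lemma norm_embK (V : normedZmodType K) (v : V) : emb (re `|v|) = `|v|.
Proof. exact: ge0_embK. Qed.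

Lemma absK_ge0 c : 0 <= absK c. Proof. exact: re_ge0. Qed.

Lemma absKM c d : absK (c * d) = absK c * absK d.
Proof. by rewrite /absK normrM -{1}(norm_embK c) re_emb_mul. Qed.

Lemma absK0 : absK 0 = 0. Proof. by rewrite /absK normr0 -emb0 embK. Qed.

Lemma absK1 : absK 1 = 1. Proof. by rewrite /absK normr1 -emb1 embK. Qed.

Lemma absK_eq0 c : (absK c == 0) = (c == 0).
Proof.
apply/eqP/eqP => [c0|->]; last exact: absK0.
by apply: normr0_eq0; rewrite -norm_embK -/(absK c) c0 emb0.
Qed.

Lemma absKD c d : absK (c + d) <= absK c + absK d.
Proof. by rewrite /absK -re_add; apply: re_le; exact: ler_normD. Qed.

Lemma absKN c : absK (- c) = absK c. Proof. by rewrite /absK normrN. Qed.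

Lemma absK_emb r : absK (emb r) = `|r|.
Proof.
have [r0|r0] := leP 0 r.
  by rewrite (ger0_norm r0) /absK ger0_norm ?embK // -emb0 emb_le.
by rewrite (ltr0_norm r0) /absK ltr0_norm -?emb_opp ?embK // -emb0 emb_lt.
Qed.

Lemma absKV c : absK c^-1 = (absK c)^-1.
Proof.
have [->|c0] := eqVneq c 0; first by rewrite invr0 absK0 invr0.
have ac0 : absK c != 0 by rewrite absK_eq0.
by apply: (mulfI ac0); rewrite -absKM !divff // absK1.
Qed.

Lemma norm_re_le c : `|re c| <= absK c.
Proof.
rewrite /absK /real_part; case: k c => [c|c] //=.
by have := normc_ge_Re c; rewrite lecE => /andP[_].
Qed.

Lemma normC_i : `|'i%C| = 1 :> R[i].
Proof. by rewrite normc_def /= expr0n /= add0r expr1n sqrtr1. Qed.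

Lemma norm_im_le c : `|im c| <= absK c.
Proof.
rewrite /absK /real_part /im; case: k c => [c|c] /=; first by rewrite normr0.
rewrite (_ : complex.Im c = - complex.Re (c * 'i%C)); last by rewrite ReiNIm opprK.
have := normc_ge_Re (c * 'i%C).
by rewrite normrM normC_i mulr1 lecE normrN => /andP[_].
Qed.

Lemma absK_iu : absK iu <= 1.
Proof.
rewrite /absK /real_part /iu; case: k; first by rewrite normr0 ler01.
by rewrite normC_i.
Qed.

Lemma absK_le_re_im c : absK c <= `|re c| + `|im c|.
Proof.
rewrite {1}[c]scalarE; apply: le_trans (absKD _ _) _.
rewrite absKM !absK_emb lerD2l -[leRHS]mul1r ler_wpM2r //; exact: absK_iu.
Qed.

Lemma absK_sum (I : Type) (r : seq I) (F : I -> K) :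
  absK (\sum_(i <- r) F i) <= \sum_(i <- r) absK (F i).
Proof.
elim/big_ind2: _ => [||//]; first by rewrite absK0.
by move=> x a y b xa yb; apply: le_trans (absKD _ _) (lerD xa yb).
Qed.

Lemma re_sum (I : Type) (r : seq I) (F : I -> K) :
  re (\sum_(i <- r) F i) = \sum_(i <- r) re (F i).
Proof. by apply: (big_morph re re_add); rewrite -emb0 embK. Qed.

Lemma im_sum (I : Type) (r : seq I) (F : I -> K) :
  im (\sum_(i <- r) F i) = \sum_(i <- r) im (F i).
Proof.
apply: (big_morph im im_add).
by have := im_emb_mul 0 0; rewrite mulr0 mul0r.
Qed.

(** Bounded sets of scalars are totally bounded. *)
Lemma scalar_grid (D e : R) : 0 < e ->
  exists gs : seq K, forall c, absK c <= D -> exists2 g, g \in gs & absK (c - g) <= e.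
Proof.
move=> e0.
have [D0|D0] := ltP D 0.
  by exists [::] => c cD; have := absK_ge0 c; rewrite leNgt (le_lt_trans cD).
have [n nP] : exists n : nat, 2 * D / (e / 2) < n%:R.
  by exists (Num.truncn (2 * D / (e / 2))).+1; apply: truncnS_gt.
pose pts : seq R := [seq j%:R * (e / 2) - D | j <- iota 0 n].
have ptsP r : `|r| <= D -> exists2 g, g \in pts & `|r - g| <= e / 2.
  rewrite ler_norml => /andP[rD Dr].
  have e2 : 0 < e / 2 by lra.
  pose j := Num.truncn ((r + D) / (e / 2)).
  have rD0 : 0 <= (r + D) / (e / 2) by apply: divr_ge0; lra.
  have /andP[jle jgt] := truncn_itv rD0.
  have jn : (j < n)%N.
    rewrite -(ltr_nat R); apply: le_lt_trans jle _; apply: le_lt_trans nP.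
    by rewrite ler_pM2r ?invr_gt0 //; lra.
  exists (j%:R * (e / 2) - D); first by apply/mapP; exists j; rewrite // mem_iota.
  move: jle jgt; rewrite ler_pdivlMr // ltr_pdivrMr // -natr1 -/j => jle jgt.
  by rewrite ler_norml; apply/andP; split; nra.
exists [seq emb a + iu * emb b | a <- pts, b <- pts] => c cD.
have [a apts ca] := ptsP _ (le_trans (norm_re_le c) cD).
have [b bpts cb] := ptsP _ (le_trans (norm_im_le c) cD).
exists (emb a + iu * emb b); first exact: allpairs_f.
rewrite {1}[c]scalarE (_ : _ - _ = emb (re c - a) + iu * emb (im c - b)); last first.
  by rewrite !emb_add !emb_opp; ring.
apply: le_trans (absKD _ _) _; rewrite absKM !absK_emb.
have : absK iu * `|im c - b| <= 1 * `|im c - b| by rewrite ler_wpM2r // absK_iu.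
lra.
Qed.

Definition sgnK (b : bool) : K := if b then 1 else -1.

(** Take the signs of the real parts or those of the imaginary parts, whichever
    have the larger l_1 norm. *)
Lemma scalar_signs (s : seq nat) (c : nat -> K) : exists th : nat -> bool,
  \sum_(i <- s) absK (c i) <= 2 * absK (\sum_(i <- s) sgnK (th i) * c i).
Proof.
have sgnE (x : R) : emb (if 0 <= x then 1 else -1) = sgnK (0 <= x).
  by rewrite /sgnK; case: ifP; rewrite ?emb_opp emb1.
have absE (x : R) : (if 0 <= x then 1 else -1) * x = `|x|.
  case: (leP 0 x) => x0; first by rewrite mul1r ger0_norm.
  by rewrite mulN1r ltr0_norm.
have le_s : \sum_(i <- s) absK (c i) <=
    \sum_(i <- s) `|re (c i)| + \sum_(i <- s) `|im (c i)|.
  by rewrite -big_split; apply: ler_sum => i _; apply: absK_le_re_im.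
have [le|lt] := leP (\sum_(i <- s) `|im (c i)|) (\sum_(i <- s) `|re (c i)|).
  exists (fun i => 0 <= re (c i)); apply: le_trans le_s _.
  have := norm_re_le (\sum_(i <- s) sgnK (0 <= re (c i)) * c i).
  rewrite re_sum (eq_bigr (fun i => `|re (c i)|)).
    by rewrite ger0_norm ?sumr_ge0 // => h; lra.
  by move=> i _; rewrite -sgnE re_emb_mul.
exists (fun i => 0 <= im (c i)); apply: le_trans le_s _.
have := norm_im_le (\sum_(i <- s) sgnK (0 <= im (c i)) * c i).
rewrite im_sum (eq_bigr (fun i => `|im (c i)|)).
  by rewrite ger0_norm ?sumr_ge0 // => h; lra.
by move=> i _; rewrite -sgnE im_emb_mul.
Qed.

Definition nrm (X : normedModType K) (v : X) : R := re `|v|.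

Section Norm.
Variable X : normedModType K.
Implicit Types v w : X.

Lemma nrm_embK v : emb (nrm v) = `|v|. Proof. exact: norm_embK. Qed.

Lemma nrm_ge0 v : 0 <= nrm v. Proof. exact: re_ge0. Qed.

Lemma nrm0 : nrm (0 : X) = 0. Proof. by rewrite /nrm normr0 -emb0 embK. Qed.

Lemma nrmD v w : nrm (v + w) <= nrm v + nrm w.
Proof. by rewrite /nrm -re_add; apply: re_le; exact: ler_normD. Qed.

Lemma nrmN v : nrm (- v) = nrm v. Proof. by rewrite /nrm normrN. Qed.

Lemma nrmB v w : nrm v - nrm w <= nrm (v + w).
Proof. by rewrite lerBlDr -(nrmN w) -{1}(addrK w v); exact: nrmD. Qed.

Lemma nrmZ c v : nrm (c *: v) = absK c * nrm v.
Proof. by rewrite /nrm normrZ -{1}(norm_embK c) re_emb_mul. Qed.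

Lemma nrmMn v n : nrm (v *+ n) = n%:R * nrm v.
Proof.
rewrite /nrm normrMn mulr_natl; elim: n => [|n IH]; last by rewrite !mulrS re_add IH.
by rewrite !mulr0n -emb0 embK.
Qed.

Lemma nrm_sum (I : Type) (r : seq I) (F : I -> X) :
  nrm (\sum_(i <- r) F i) <= \sum_(i <- r) nrm (F i).
Proof.
elim/big_ind2: _ => [||//]; first by rewrite nrm0.
by move=> x a y b xa yb; apply: le_trans (nrmD _ _) (lerD xa yb).
Qed.

End Norm.

Lemma bounded_operatorP (X Y : completeNormedModType K) (A : {linear X -> Y}) :
  bounded_operator A <-> exists2 M, 0 < M & forall x, nrm (A x) <= M * nrm x.
Proof.
split=> [[M AM]|[M M0 AM]]; last first.
  by exists (emb M) => x; rewrite -!nrm_embK -emb_mul emb_le.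
exists (absK M + 1) => [|x]; first by have := absK_ge0 M; lra.
have Mx : 0 <= M * `|x| := le_trans (normr_ge0 _) (AM x).
have := re_le (AM x); rewrite -[X in _ <= re X]ger0_norm // normrM normr_id.
rewrite -{1}(norm_embK M) re_emb_mul -/(nrm _) -/(absK M) -/(nrm x).
by move=> h; have := nrm_ge0 x; nra.
Qed.

End Scalars.

#[global] Opaque absK nrm emb im iu.

(** * Spreading models along a family of increasing sequences *)

Lemma incr_inv (f : nat -> nat) : {homo f : i j / (i < j)%N} ->
  exists g, cancel f g.
Proof.
move=> f_incr; have f_inj : injective f.
  by move=> i j fij; case: (ltngtP i j) => // /f_incr; rewrite fij ltnn.
have gP j : exists i, forall i', f i' = j -> i' = i.
  have [[i fi]|no] := EM (exists i, f i = j).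
    by exists i => i' fi'; apply: f_inj; rewrite fi.
  by exists 0%N => i fi; case: no; exists i.
have [g gfP] := choice gP; exists g => i.
by apply/esym; apply: gfP.
Qed.

Section SpreadingModels.
Variables (R : realType) (k : scalar_kind) (p : \bar R).
Hypothesis hp : (1 <= p)%E.
Local Notation K := (scalars R k).
Implicit Types (s : seq nat) (c : nat -> K).

Definition lp_seq s c : R :=
  match p with
  | EFin r => (\sum_(i <- s) absK (c i) `^ r) `^ r^-1
  | +oo%E => \big[Num.max/0]_(i <- s) absK (c i)
  | -oo%E => 0
  end.

Lemma lp_normE s c : sorted ltn s -> lp_norm p (fs s) c = lp_seq s c.
Proof.
by move=> ss; rewrite /lp_norm /lp_seq; case: p => [r||] //;
  rewrite (perm_big _ (perm_fs ss)).
Qed.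

Lemma lp_max_ge0 s c : 0 <= \big[Num.max/0]_(i <- s) absK (c i).
Proof.
elim/big_ind: _ => // [x y x0 y0|i _]; last exact: absK_ge0.
by rewrite le_max x0.
Qed.

Lemma lp_seq_ge0 s c : 0 <= lp_seq s c.
Proof.
rewrite /lp_seq; case: p => [r||] //; first exact: powR_ge0.
exact: lp_max_ge0.
Qed.

Lemma exponent_cases : p = +oo%E \/ exists2 r : R, 0 < r & p = r%:E.
Proof.
case: p hp => [r||//]; last by left.
by rewrite lee_fin => /(lt_le_trans ltr01) r0; right; exists r.
Qed.

Lemma lp_seq_abs s c i : i \in s -> absK (c i) <= lp_seq s c.
Proof.
move=> is_; rewrite /lp_seq; have [->|[r r0 ->]] := exponent_cases.
  exact: (le_bigmax_seq 0 i xpredT (fun i => absK (c i))).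
rewrite -[leLHS](powRr1 (absK_ge0 _)) -[X in _ `^ X <= _](divff (lt0r_neq0 r0)) powRrM.
apply: ge0_ler_powR; rewrite ?nnegrE ?powR_ge0 ?invr_ge0 ?(ltW r0) //.
  by apply: sumr_ge0 => j _; exact: powR_ge0.
rewrite (perm_big _ (perm_to_rem is_)) big_cons lerDl.
by apply: sumr_ge0 => j _; exact: powR_ge0.
Qed.

Lemma eq_lp_seq s c c' : {in s, forall i, absK (c i) = absK (c' i)} ->
  lp_seq s c = lp_seq s c'.
Proof.
move=> cc'; rewrite /lp_seq; case: p => [r| |]; [|exact: eq_big_seq|by []].
by congr (_ `^ _); apply: eq_big_seq => i is_; rewrite (cc' i is_).
Qed.

Lemma lp_seq_map (f : nat -> nat) s c : lp_seq (map f s) c = lp_seq s (c \o f).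
Proof. by rewrite /lp_seq; case: p => [r| |]; [rewrite big_map|rewrite big_map|]. Qed.

Lemma lp_seqZ s c (t : K) : lp_seq s (fun i => t * c i) = absK t * lp_seq s c.
Proof.
rewrite /lp_seq; have [->|[r r0 ->]] := exponent_cases; last first.
  under eq_bigr => i _ do rewrite absKM powRM ?absK_ge0 //.
  rewrite -mulr_sumr powRM ?powR_ge0 //; last first.
    by apply: sumr_ge0 => j _; exact: powR_ge0.
  by rewrite -powRrM divff ?lt0r_neq0 // powRr1 ?absK_ge0.
elim: s => [|i s IH]; first by rewrite !big_nil mulr0.
by rewrite !big_cons IH absKM maxr_pMr ?absK_ge0.
Qed.

(** Normalised blocks are isometric to the canonical basis. *)
Lemma lp_seq_blocks s (e : nat -> seq nat) c C (cs : nat -> nat -> K) :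
  {in s, forall n, lp_seq (e n) (cs n) = 1} ->
  {in s, forall n, {in e n, forall i, absK (C i) = absK (c n * cs n i)}} ->
  lp_seq (flatten [seq e n | n <- s]) C = lp_seq s c.
Proof.
move=> e1 CE.
have bE n : n \in s -> lp_seq (e n) C = absK (c n).
  move=> ns; rewrite (@eq_lp_seq _ _ (fun i => c n * cs n i)); last exact: CE.
  by rewrite lp_seqZ e1 // mulr1.
move: bE; rewrite /lp_seq {CE e1}; have [->|[r r0 ->]] := exponent_cases => bE; last first.
  congr (_ `^ _); rewrite big_flatten big_map.
  apply: eq_big_seq => n ns; rewrite -bE // -powRrM mulVf ?lt0r_neq0 // powRr1 //.
  by apply: sumr_ge0 => j _; exact: powR_ge0.
elim: s bE => [|n s IH] bE; first by rewrite !big_nil.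
rewrite /= big_cons -IH => [|m ms]; last by apply: bE; rewrite inE ms orbT.
rewrite -bE ?mem_head //.
elim: (e n) => [|i t IHt] /=; first by rewrite big_nil max_r // lp_max_ge0.
by rewrite !big_cons IHt maxA.
Qed.

Lemma lp_seq1 s c : p = 1%E -> lp_seq s c = \sum_(i <- s) absK (c i).
Proof.
move=> p1; rewrite /lp_seq p1 invr1 powRr1.
  by apply: eq_bigr => i _; rewrite powRr1 // absK_ge0.
by apply: sumr_ge0 => i _; exact: powR_ge0.
Qed.

Lemma lp_seq_oo_le s c M : p = +oo%E -> 0 <= M ->
  {in s, forall i, absK (c i) <= M} -> lp_seq s c <= M.
Proof.
move=> poo M0 cM; rewrite /lp_seq poo big_seq.
by apply: bigmax_le => // i; exact: cM.
Qed.

Section Sequences.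
Variable X : completeNormedModType K.
Implicit Types x : nat -> X.

Definition comb x s c : X := \sum_(i <- s) c i *: x i.

Lemma lin_normE x s c : sorted ltn s -> lin_norm x (fs s) c = nrm (comb x s c).
Proof. by move=> ss; rewrite /lin_norm (perm_big _ (perm_fs ss)). Qed.

Lemma comb_map (f : nat -> nat) x s c : comb x (map f s) c = comb (x \o f) s (c \o f).
Proof. by rewrite /comb big_map. Qed.

Lemma combZ x s c (t : K) : comb x s (fun i => t * c i) = t *: comb x s c.
Proof. by rewrite /comb scaler_sumr; apply: eq_bigr => i _; rewrite scalerA. Qed.

Definition lower (F : set (seq nat)) x (a : R) : Prop :=
  forall s, F s -> forall c, lp_seq s c <= a * nrm (comb x s c).

Definition upper (F : set (seq nat)) x (b : R) : Prop :=
  forall s, F s -> forall c, nrm (comb x s c) <= b * lp_seq s c.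

Lemma spreading_modelP F x : spreading_model p F x <->
  (exists2 a, 0 < a & lower (listed F) x a) /\
  (exists2 b, 0 < b & upper (listed F) x b).
Proof.
split=> [[a [b [a0 b0 ab]]]|[[a a0 la] [b b0 ub]]].
  by split; [exists a|exists b] => // s [ss Fs] c; have [] := ab _ Fs c;
    rewrite lp_normE // lin_normE.
exists a, b; split=> // E FE c.
have FE' : listed F (sort leq E).
  by split; [exact: sort_fset_sorted | rewrite fs_sort].
rewrite -(fs_sort E) lp_normE ?lin_normE ?sort_fset_sorted //.
by split; [apply: la | apply: ub].
Qed.

Lemma lower_sub (F F' : set (seq nat)) x a (f : nat -> nat) :
  {homo f : i j / (i < j)%N} -> (forall s, F s -> F' (map f s)) ->
  lower F' x a -> lower F (x \o f) a.
Proof.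
move=> /incr_inv[g gK] FF' la s Fs c; have := la _ (FF' _ Fs) (c \o g).
rewrite lp_seq_map comb_map.
by rewrite (_ : (c \o g) \o f = c) //; apply/funext => i /=; rewrite gK.
Qed.

Lemma upper_sub (F F' : set (seq nat)) x b (f : nat -> nat) :
  {homo f : i j / (i < j)%N} -> (forall s, F s -> F' (map f s)) ->
  upper F' x b -> upper F (x \o f) b.
Proof.
move=> /incr_inv[g gK] FF' ub s Fs c; have := ub _ (FF' _ Fs) (c \o g).
rewrite lp_seq_map comb_map.
by rewrite (_ : (c \o g) \o f = c) //; apply/funext => i /=; rewrite gK.
Qed.

End Sequences.

Section Images.
Variables (X Y : completeNormedModType K).
Implicit Types (x : nat -> X) (A B : {linear X -> Y}).

Lemma comb_image A x s c : A (comb x s c) = comb (A \o x) s c.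
Proof. by rewrite /comb linear_sum; apply: eq_bigr => i _; rewrite linearZ. Qed.

Lemma upper_image F A x M b : 0 <= M -> (forall v, nrm (A v) <= M * nrm v) ->
  upper F x b -> upper F (A \o x) (M * b).
Proof.
move=> M0 AM ub s Fs c; rewrite -comb_image; apply: le_trans (AM _) _.
by rewrite -mulrA ler_wpM2l // ub.
Qed.

Lemma lower_of_image F A x M a : 0 <= a -> (forall v, nrm (A v) <= M * nrm v) ->
  lower F (A \o x) a -> lower F x (a * M).
Proof.
move=> a0 AM la s Fs c; apply: le_trans (la _ Fs c) _.
by rewrite -mulrA ler_wpM2l // -comb_image.
Qed.

Lemma lower_perturb F A B x a b e : 0 < a -> 0 < b -> 0 <= e ->
  (forall v, nrm (A v - B v) <= e * nrm v) -> e * (2 * a * b) <= 1 ->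
  lower F (A \o x) a -> upper F x b -> lower F (B \o x) (2 * a).
Proof.
move=> a0 b0 e0 ABe eab la ub s Fs c.
have := la _ Fs c; rewrite -!comb_image; set v := comb x s c => lav.
have vB : nrm (A v) <= nrm (B v) + e * nrm v.
  by rewrite -[A v](subrK (B v)) addrC; apply: le_trans (nrmD _ _) _; rewrite lerD2l.
have vb : e * nrm v <= e * (b * lp_seq s c) by rewrite ler_wpM2l // ub.
have l0 := lp_seq_ge0 s c.
have h1 : a * (e * nrm v) <= a * (e * (b * lp_seq s c)) by rewrite ler_wpM2l // ltW.
have h2 : (e * (2 * a * b)) * lp_seq s c <= 1 * lp_seq s c by rewrite ler_wpM2r.
have h3 : a * nrm (A v) <= a * (nrm (B v) + e * nrm v) by rewrite ler_wpM2l // ltW.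
rewrite mulrDr in h3.
have h4 : a * (e * (b * lp_seq s c)) * 2 = e * (2 * a * b) * lp_seq s c by ring.
lra.
Qed.

(** The upper estimate always passes to the image, so that only the lower one
    can be lost. *)
Lemma SM_P (F : set {fset nat}) A : @SM R k p F X Y A <->
  bounded_operator A /\ forall x, spreading_model p F x ->
    forall a, 0 < a -> ~ lower (listed F) (A \o x) a.
Proof.
split=> -[bA nA]; split=> // x xF; last first.
  by move=> /spreading_modelP[[a a0 la] _]; exact: nA xF a a0 la.
move=> a a0 la; apply: (nA x xF); apply/spreading_modelP; split; first by exists a.
have /bounded_operatorP[M M0 AM] := bA.
have /spreading_modelP[_ [b b0 ub]] := xF.
by exists (M * b); [exact: mulr_gt0 | apply: upper_image => //; exact: ltW].
Qed.

Definition admits_short (F : set {fset nat}) : Prop :=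
  forall N, exists m, forall s, (size s <= N)%N -> sorted ltn s ->
    all (ltn m) s -> listed F s.

(** Among n + 1 vectors in the span of n there is a linear relation, which
    contradicts a lower estimate on any n + 1 points. *)
Lemma SM_finite_rank (F : set {fset nat}) A : admits_short F ->
  bounded_operator A -> finite_rank A -> @SM R k p F X Y A.
Proof.
move=> Fshort bA [n [v Av]]; apply/SM_P; split=> // x _ a a0 la.
have /choice[C CP] i : exists c : 'I_n -> K, A (x i) = \sum_j c j *: v j by apply: Av.
have [m mP] := Fshort n.+1; pose s := iota m.+1 n.+1.
have Fs : listed F s.
  apply: mP; rewrite ?size_iota ?iota_ltn_sorted //.
  by apply/allP => i; rewrite mem_iota => /andP[].
pose Mx : 'M[K]_(n.+1, n) := \matrix_(i, j) C (m.+1 + i)%N j.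
have /rowV0Pn[u uker u0] : kermx Mx != 0.
  rewrite kermx_eq0 -row_leq_rank -ltnNge ltnS; exact: rank_leq_col.
have {}uker : u *m Mx = 0 by apply/sub_kermxP.
have [i ui] : exists i, u 0 i != 0.
  apply: contrapT => nou; move/eqP: u0; apply; apply/rowP => i; rewrite mxE.
  by apply: contrapT => /eqP ui; apply: nou; exists i.
pose c i := u 0 (inord (i - m.+1)%N).
have sE : s = [seq (m.+1 + val i)%N | i : 'I_n.+1].
  by rewrite /s -[in LHS](addn0 m.+1) iotaDl -val_enum_ord -map_comp.
have cE (j : 'I_n.+1) : c (m.+1 + j)%N = u 0 j by rewrite /c addKn inord_val.
have A0 : comb (A \o x) s c = 0.
  rewrite /comb sE big_image /=.
  under eq_bigr => j _ do rewrite cE CP scaler_sumr.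
  rewrite exchange_big big1 //= => j _.
  under eq_bigr => i' _ do rewrite scalerA.
  rewrite -scaler_suml (_ : \sum_i0 _ = (u *m Mx) 0 j).
    by rewrite uker mxE scale0r.
  by rewrite mxE; apply: eq_bigr => i' _; rewrite mxE.
have := la _ Fs c; rewrite A0 nrm0 mulr0 leNgt => /negP; apply.
apply: lt_le_trans (@lp_seq_abs s c (m.+1 + i)%N _); last first.
  by rewrite sE; apply/mapP; exists i; rewrite // mem_enum.
by rewrite cE lt_neqAle absK_ge0 andbT eq_sym absK_eq0.
Qed.

Lemma SM_scale (F : set {fset nat}) (t : K) A :
  @SM R k p F X Y A -> @SM R k p F X Y (t \*: A).
Proof.
move=> /SM_P[bA nA]; apply/SM_P; split.
  have /bounded_operatorP[M M0 AM] := bA.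
  apply/bounded_operatorP; exists ((absK t + 1) * M).
    by rewrite mulr_gt0 // ltr_wpDl // absK_ge0.
  move=> x; rewrite /= nrmZ; have := AM x; have := absK_ge0 t; have := nrm_ge0 x.
  have := nrm_ge0 (A x); nra.
move=> x xF a a0 la; apply: (nA x xF (a * (absK t + 1))).
  by rewrite mulr_gt0 // ltr_wpDl // absK_ge0.
move=> s Fs c; apply: le_trans (la _ Fs c) _.
rewrite -mulrA ler_wpM2l ?(ltW a0) //.
rewrite (_ : comb _ s c = t *: comb (A \o x) s c).
  by rewrite nrmZ ler_wpM2r ?nrm_ge0 // lerDl.
by rewrite /comb scaler_sumr; apply: eq_bigr => i _ /=; rewrite !scalerA mulrC.
Qed.

Lemma SM_mono (F F' : set {fset nat}) (f : nat -> nat) A :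
  {homo f : i j / (i < j)%N} -> (forall s, listed F s -> listed F' (map f s)) ->
  @SM R k p F X Y A -> @SM R k p F' X Y A.
Proof.
move=> f_incr FF' /SM_P[bA nA]; apply/SM_P; split=> // x.
move=> /spreading_modelP[[a a0 la] [b b0 ub]] a' a'0 la'.
apply: (nA (x \o f) _ a' a'0).
  apply/spreading_modelP; split; [exists a | exists b] => //.
    exact: lower_sub la.
  exact: upper_sub ub.
exact: (@lower_sub _ _ _ (A \o x)) la'.
Qed.

Lemma bounded_operatorD A B : bounded_operator A -> bounded_operator B ->
  bounded_operator (A \+ B : {linear X -> Y}).
Proof.
move=> /bounded_operatorP[M M0 AM] /bounded_operatorP[N N0 BN].
apply/bounded_operatorP; exists (M + N) => [|x /=]; first exact: addr_gt0.
by apply: le_trans (nrmD _ _) _; rewrite mulrDl lerD.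
Qed.

End Images.

Lemma SM_comp (F : set {fset nat}) (V X Y Z : completeNormedModType K)
    (C : {linear V -> X}) (A : {linear X -> Y}) (B : {linear Y -> Z}) :
  bounded_operator C -> @SM R k p F X Y A -> bounded_operator B ->
  @SM R k p F V Z (B \o (A \o C)).
Proof.
move=> /bounded_operatorP[M M0 CM] /SM_P[/bounded_operatorP[N N0 AN] nA].
move=> /bounded_operatorP[L L0 BL]; apply/SM_P; split.
  apply/bounded_operatorP; exists (L * (N * M)); first by rewrite !mulr_gt0.
  move=> x /=; apply: le_trans (BL _) _; rewrite -mulrA ler_wpM2l ?(ltW L0) //.
  by apply: le_trans (AN _) _; rewrite -mulrA ler_wpM2l ?(ltW N0).
move=> x /spreading_modelP[_ [b b0 ub]] a a0 la.
have lAC : lower (listed F) (A \o (C \o x)) (a * L).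
  by apply: (@lower_of_image _ _ _ B (A \o (C \o x))) la => //; exact: ltW.
apply: (nA (C \o x) _ (a * L)) => //; last exact: mulr_gt0.
apply/spreading_modelP; split.
  exists (a * L * N); first by rewrite !mulr_gt0.
  by apply: lower_of_image lAC => //; rewrite mulr_ge0 ?ltW.
by exists (M * b); [exact: mulr_gt0 | apply: upper_image => //; exact: ltW].
Qed.

(** If [A] preserves some spreading model, then so does every operator close
    enough to [A], the distance depending on the constants of the model. *)
Lemma SM_closed (F : set {fset nat}) : closed_class (@SM R k p F).
Proof.
move=> X Y A bA Aclose; apply/SM_P; split=> // x xF a a0 la.
have /spreading_modelP[_ [b b0 ub]] := xF.
have ab0 : 0 < 2 * a * b by rewrite !mulr_gt0.
have e0 : 0 < (2 * a * b)^-1 by rewrite invr_gt0.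
have [|B /SM_P[_ nB] ABe] := Aclose (emb k (2 * a * b)^-1).
  by rewrite -(emb0 R) emb_lt.
apply: (nB x xF (2 * a)); first by rewrite mulr_gt0.
apply: (lower_perturb a0 b0 (ltW e0) _ _ la ub); last by rewrite mulVf ?lt0r_neq0.
by move=> v; rewrite -(emb_le k) emb_mul !nrm_embK.
Qed.

End SpreadingModels.

(** * Sums of operators: the case of c_0 *)

Section CZero.
Variables (R : realType) (k : scalar_kind).
Local Notation K := (scalars R k).
Local Notation oo := (+oo%E : \bar R).
Local Notation lpoo := (@lp_seq R k oo).
Variables (Y : completeNormedModType K) (F : set {fset nat}) (y : nat -> Y) (b d : R).
Hypothesis (Fshort : admits_short F) (b0 : 0 < b) (yb : upper oo (listed F) y b).

Lemma sumr_const_seq (V : nmodType) (I : Type) (s : seq I) (v : V) :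
  \sum_(i <- s) v = v *+ size s.
Proof. by elim: s => [|i s IH]; rewrite ?big_nil // big_cons IH mulrS. Qed.

Let hoo : (1 <= oo)%E. Proof. exact: leey. Qed.

Lemma lp_seq_oo_attained s c : 0 < lpoo s c ->
  exists2 j, j \in s & absK (c j) = lpoo s c.
Proof.
rewrite /lp_seq; elim: s => [|i s IH]; first by rewrite big_nil ltxx.
rewrite big_cons; case: (leP (absK (c i)) _) => [_ pos|_ _].
  by have [j js jE] := IH pos; exists j; rewrite // inE js orbT.
by exists i; rewrite // mem_head.
Qed.

Lemma comb_restrict (z : nat -> Y) s c m : sorted ltn s ->
  (forall i, i \in s -> (i < m)%N) ->
  comb z (iota 0 m) (fun i => if i \in s then c i else 0) = comb z s c.
Proof.
move=> ss sm; rewrite /comb.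
rewrite (eq_bigr (fun i => if i \in s then c i *: z i else 0)); last first.
  by move=> i _; case: ifP => _; rewrite ?scale0r.
rewrite -big_mkcond -big_filter (_ : [seq i <- _ | _] = s) //.
apply: eq_sorted_ltn => // [|i]; last first.
  by rewrite mem_filter mem_iota /= add0n; apply: andb_idr; exact: sm.
by apply: sorted_filter; [exact: ltn_trans | exact: iota_ltn_sorted].
Qed.

Lemma ultra_seq (U : set (set nat)) (UU : UltraFilter U) (J : set nat) :
  (forall m, U [set n | (m < n)%N]) -> U J -> forall N m, exists s,
  [/\ size s = N, sorted ltn s, all (ltn m) s & forall n, n \in s -> J n].
Proof.
move=> U_free UJ; elim=> [|N IH] m; first by exists [::].
have [n [mn Jn]] := ultra_ex UU (ultra_and UU (U_free m) UJ).
have [s [sN ss ns Js]] := IH n; exists (n :: s); split.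
- by rewrite /= sN.
- by rewrite /= (path_sortedE ltn_trans) ns.
- rewrite /= mn; apply/allP => i /(allP ns) /=; exact: ltn_trans.
- by move=> i; rewrite inE => /orP[/eqP->|/Js].
Qed.

(** A c_0 upper estimate makes [y] asymptotically orthogonal to any finite
    part of it: if many y_n shortened the same vector v by e, the average of
    v + t_n y_n would too, but averages of the t_n y_n tend to 0. *)
Lemma c0_asymptotic (U : set (set nat)) (UU : UltraFilter U) (L : seq nat) (e : R) :
  (forall m, U [set n | (m < n)%N]) -> 0 < e ->
  U [set n | forall (c : nat -> K) (t : K),
      (forall i, i \in L -> absK (c i) <= 1) -> absK t <= 1 ->
      nrm (comb y L c) - e <= nrm (comb y L c + t *: y n)].
Proof.
move=> U_free e0; set P := mkset _; have [//|UnP] := in_ultra_setVsetC P UU.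
have /choice[ct ctP] n : exists ct : (nat -> K) * K, ~ P n ->
    [/\ forall i, i \in L -> absK (ct.1 i) <= 1, absK ct.2 <= 1
      & nrm (comb y L ct.1 + ct.2 *: y n) < nrm (comb y L ct.1) - e].
  have [Pn|nPn] := EM (P n); first by exists (fun=> 0, 0).
  apply: contrapT => noct; apply: nPn => c t cL t1; rewrite leNgt; apply/negP => lt.
  by apply: noct; exists (c, t).
pose B0 := \sum_(i <- L) nrm (y i).
have B0_ge0 : 0 <= B0 by apply: sumr_ge0 => i _; exact: nrm_ge0.
pose h := e / (4 * (B0 + 1)).
have h0 : 0 < h by apply: divr_gt0; lra.
have hB : h * B0 <= e / 4.
  rewrite /h mulrAC ler_pdivrMr; last lra.
  lra.
have [gs gsP] := @scalar_grid R k 1 h h0.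
have /choice[ch chP] i : exists g, i \in L -> U [set n | ~ P n /\ absK ((ct n).1 i - g) <= h].
  have [iL|] := boolP (i \in L); last by exists 0.
  have : U [set n | exists2 g, g \in gs & ~ P n /\ absK ((ct n).1 i - g) <= h].
    apply: (ultra_mono UU) UnP => n nPn; have [c1 _ _] := ctP n nPn.
    by have [g ggs cg] := gsP _ (c1 i iL); exists g.
  by move=> /(ultra_exists UU)[g _ Ug]; exists g.
have UJ := ultra_and UU UnP (ultra_all UU chP).
have close n : (~` P `&` [set n | forall i, i \in L -> ~ P n /\ absK ((ct n).1 i - ch i) <= h]) n ->
    absK (ct n).2 <= 1 /\ nrm (comb y L ch + (ct n).2 *: y n) <= nrm (comb y L ch) - e / 2.
  move=> [nPn cl]; have [_ t1 lt] := ctP n nPn; split=> //.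
  have dist : nrm (comb y L ch - comb y L (ct n).1) <= e / 4.
    rewrite /comb -sumrB; apply: le_trans (nrm_sum _ _) _.
    apply: le_trans hB; rewrite /B0 mulr_sumr !big_seq; apply: ler_sum => i iL.
    rewrite -scalerBl nrmZ ler_wpM2r ?nrm_ge0 // -absKN opprB.
    by have [] := cl i iL.
  have h1 := nrmD (comb y L (ct n).1 + (ct n).2 *: y n) (comb y L ch - comb y L (ct n).1).
  have h2 := nrmD (comb y L ch) (comb y L (ct n).1 - comb y L ch).
  move: h1 h2; rewrite addrC !subrKC -(nrmN (comb y L (ct n).1 - _)) opprB.
  rewrite (_ : _ + (_ + _) = comb y L ch + (ct n).2 *: y n); last first.
    by rewrite addrA subrK.
  by move: lt => /=; lra.
pose N := (Num.truncn (2 * b / e)).+1.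
have Ngt : 2 * b / e < N%:R := truncnS_gt _.
have [m mP] := Fshort N.
have [s [sN ss ms Js]] := ultra_seq UU U_free UJ N m.
have Fs : listed F s by apply: mP; rewrite ?sN.
(* With N > 2 b / e the average of the N vectors is too long. *)
pose t n := (ct n).2.
have sumle : nrm (\sum_(n <- s) (comb y L ch + t n *: y n)) <=
    N%:R * (nrm (comb y L ch) - e / 2).
  apply: le_trans (nrm_sum _ _) _; rewrite -sN mulr_natl -sumr_const_seq big_seq.
  by rewrite [leRHS]big_seq; apply: ler_sum => n /Js/close[].
have wb : nrm (comb y s t) <= b.
  apply: le_trans (yb Fs t) _; rewrite -[leRHS]mulr1 ler_wpM2l ?(ltW b0) //.
  by apply: lp_seq_oo_le => // i /Js/close[].
have := nrmB (comb y L ch *+ N) (comb y s t).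
move: sumle; rewrite big_split /= sumr_const_seq sN -/(comb y s t) nrmMn => le1 le2.
by move: Ngt; rewrite ltr_pdivrMr //; lra.
Qed.

(** Choosing the points of the subsequence one after the other by
    [c0_asymptotic] makes it almost basic: initial sums are hardly longer than
    the whole sum, and each term is the difference of two of them. *)
Lemma c0_lower : 0 < d -> (forall m, exists2 n, d <= nrm (y n) & (m < n)%N) ->
  exists2 l : nat -> nat, {homo l : i j / (i < j)%N} &
    lower oo [set s | sorted ltn s] (y \o l) (4 / d).
Proof.
move=> d0 dy; have [U [UU U_free UI]] := free_ultrafilter dy.
(* The errors allowed at the successive steps add up to d / 4. *)
pose e m := d / 4 * (1 / 2) ^+ m.+1 : R.
have e0 m : 0 < e m by rewrite mulr_gt0 ?exprn_gt0; lra.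
have step L : exists n, [/\ all (gtn n) L, d <= nrm (y n) &
    forall (c : nat -> K) (t : K),
      (forall i, i \in L -> absK (c i) <= 1) -> absK t <= 1 ->
      nrm (comb y L c) - e (size L) <= nrm (comb y L c + t *: y n)].
  have UL : U [set n | forall i, i \in L -> (i < n)%N].
    by apply: ultra_all => i _; exact: U_free.
  have Ue := c0_asymptotic UU L U_free (e0 (size L)).
  have [n [Ln [dn en]]] := ultra_ex UU (ultra_and UU UL (ultra_and UU UI Ue)).
  by exists n; split=> //; apply/allP.
have /choice[g gP] := step.
pose Ls m := iter m (fun L => rcons L (g L)) [::].
pose l m := g (Ls m).
have LsE m : Ls m = [seq l i | i <- iota 0 m].
  elim: m => [//|m IH]; rewrite [Ls _]/= -/(Ls m) -/(l m) {1}IH.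
  by rewrite -addn1 iotaD map_cat cats1.
have l_incr : {homo l : i j / (i < j)%N}.
  move=> i j ij; have [/allP + _ _] := gP (Ls j); apply.
  by rewrite LsE map_f // mem_iota.
exists l => //; pose z := y \o l.
have zd j : d <= nrm (z j) by have [] := gP (Ls j).
have [li lK] := incr_inv l_incr.
have zstep (c : nat -> K) m : (forall i, absK (c i) <= 1) ->
    nrm (comb z (iota 0 m) c) - e m <= nrm (comb z (iota 0 m.+1) c).
  move=> c1; have [_ _ /(_ (c \o li) (c m) (fun i _ => c1 _) (c1 m))] := gP (Ls m).
  rewrite -/(l m) {2}LsE size_map size_iota !LsE comb_map -/z.
  rewrite (_ : (c \o li) \o l = c); last by apply/funext => i /=; rewrite lK.
  by rewrite -[in X in _ -> X]addn1 iotaD /comb big_cat /= big_seq1.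
have ztail (c : nat -> K) m j : (forall i, absK (c i) <= 1) ->
    nrm (comb z (iota 0 m) c) - d / 4 <= nrm (comb z (iota 0 (m + j)) c).
  move=> c1; suff le : nrm (comb z (iota 0 m) c) - d / 4 * (1 / 2) ^+ m <=
      nrm (comb z (iota 0 (m + j)) c) - d / 4 * (1 / 2) ^+ (m + j).
    have p1 : (1 / 2 : R) ^+ m <= 1 by rewrite exprn_ile1; lra.
    have p0 : 0 <= (1 / 2 : R) ^+ (m + j) by rewrite exprn_ge0; lra.
    have q1 : d / 4 * (1 / 2) ^+ m <= d / 4 * 1 by rewrite ler_wpM2l //; lra.
    have q0 : 0 <= d / 4 * (1 / 2) ^+ (m + j) by rewrite mulr_ge0 //; lra.
    lra.
  elim: j => [|j IH]; first by rewrite addn0.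
  apply: le_trans IH _; have := zstep c (m + j)%N c1.
  by rewrite addnS /e exprS; lra.
move=> s ss c; have l0 := @lp_seq_ge0 R k oo s c.
have [z0|lpos] := leP (lp_seq oo s c) 0.
  by apply: le_trans z0 _; rewrite mulr_ge0 ?nrm_ge0 ?divr_ge0; lra.
have mu0 : emb k (lp_seq oo s c) != 0.
  by rewrite -absK_eq0 absK_emb normr_eq0 lt0r_neq0.
pose c' i := if i \in s then (emb k (lp_seq oo s c))^-1 * c i else 0.
have c'1 i : absK (c' i) <= 1.
  rewrite /c'; case: ifPn => [is_|_]; last by rewrite absK0.
  rewrite absKM absKV absK_emb ger0_norm // ler_pdivrMl // mulr1.
  exact: (lp_seq_abs hoo).
have [j js cj] : exists2 j, j \in s & absK (c' j) = 1.
  have [j js jE] := lp_seq_oo_attained lpos; exists j => //.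
  by rewrite /c' js absKM absKV absK_emb ger0_norm // jE mulVf // lt0r_neq0.
pose M := (\max_(i <- s) i).+1.
have combE : comb z s c = emb k (lp_seq oo s c) *: comb z (iota 0 M) c'.
  have -> : comb z (iota 0 M) c' = comb z s (fun i => (emb k (lp_seq oo s c))^-1 * c i).
    by apply: comb_restrict => // i is_; rewrite ltnS; exact: leq_bigmax_seq.
  by rewrite combZ scalerA divff // scale1r.
have jM : (j < M)%N by rewrite ltnS; exact: leq_bigmax_seq.
rewrite combE nrmZ absK_emb ger0_norm // mulrCA ler_peMr //.
suff : d / 4 <= nrm (comb z (iota 0 M) c') by rewrite mulrAC ler_pdivlMr // => h; lra.
have hj := ztail c' j (M - j)%N c'1; rewrite subnKC ?(ltnW jM) // in hj.
have hj1 := ztail c' j.+1 (M - j.+1)%N c'1; rewrite subnKC // in hj1.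
have : d <= nrm (comb z (iota 0 j) c') + nrm (comb z (iota 0 j.+1) c').
  apply: le_trans (zd j) _; rewrite -[leLHS]mul1r -cj -nrmZ.
  rewrite -addn1 iotaD /comb big_cat /= big_seq1.
  rewrite -[X in nrm X](addKr (\sum_(i <- iota 0 j) c' i *: z i)).
  by apply: le_trans (nrmD _ _) _; rewrite nrmN.
lra.
Qed.

End CZero.

Section CZeroSum.
Variables (R : realType) (k : scalar_kind).
Local Notation K := (scalars R k).
Local Notation oo := (+oo%E : \bar R).
Variable F : set {fset nat}.
Hypothesis (Fspread : spreading (listed F)) (Fshort : admits_short F).

Lemma SM_c0_null (X Y : completeNormedModType K) (A : {linear X -> Y}) (x : nat -> X) (d : R) :
  @SM R k oo F X Y A -> spreading_model oo F x -> 0 < d ->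
  exists m, forall n, (m < n)%N -> nrm (A (x n)) < d.
Proof.
have hoo : (1 <= oo)%E by exact: leey.
move=> /SM_P[bA nA] /spreading_modelP[[a a0 la] [b b0 ub]] d0.
apply: contrapT => nom.
have Ax_big m : exists2 n, d <= nrm ((A \o x) n) & (m < n)%N.
  apply: contrapT => non; apply: nom; exists m => n mn; rewrite ltNge.
  by apply/negP => dn; apply: non; exists n.
have /bounded_operatorP[M M0 AM] := bA.
have ubA := upper_image (ltW M0) AM ub.
have [l l_incr lA] := c0_lower Fshort (mulr_gt0 M0 b0) ubA d0 Ax_big.
apply: (nA (x \o l) _ (4 / d)); last by move=> s [ss _]; apply: lA.
  apply/spreading_modelP; split; [exists a | exists b] => //.
    by apply: lower_sub la => // s; apply: Fspread.
  by apply: upper_sub ub => // s; apply: Fspread.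
by apply: divr_gt0; lra.
Qed.

Lemma SM_c0_add (X Y : completeNormedModType K) (A B : {linear X -> Y}) :
  @SM R k oo F X Y A -> @SM R k oo F X Y B -> @SM R k oo F X Y (A \+ B).
Proof.
have hoo : (1 <= oo)%E by exact: leey.
move=> smA smB; apply/SM_P; split.
  by apply: bounded_operatorD; [case: smA|case: smB].
move=> x xF a a0 la; have d0 : 0 < (2 * a)^-1 by rewrite invr_gt0 mulr_gt0.
have [m mP] := SM_c0_null smA xF d0; have [m' m'P] := SM_c0_null smB xF d0.
have [j jP] := Fshort 1%N; pose n := (maxn j (maxn m m')).+1.
have /la/(_ (fun=> 1)) : listed F [:: n] by apply: jP; rewrite //= ltnS leq_maxl.
apply/negP; rewrite -ltNge.
apply: lt_le_trans (@lp_seq_abs R k oo hoo [:: n] (fun=> 1) n (mem_head _ _)).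
rewrite absK1 /comb big_seq1 scale1r /=.
have An : nrm (A (x n)) < (2 * a)^-1 by apply: mP; rewrite ltnS; lia.
have Bn : nrm (B (x n)) < (2 * a)^-1 by apply: m'P; rewrite ltnS; lia.
have : a * nrm (A (x n) + B (x n)) < a * ((2 * a)^-1 + (2 * a)^-1).
  by rewrite ltr_pM2l //; apply: le_lt_trans (nrmD _ _) _; rewrite ltrD.
by rewrite (_ : a * (_ + _) = 1) //; field; rewrite lt0r_neq0.
Qed.

End CZeroSum.

(** * Sums of operators: small blocks *)

Lemma sum_geometric_le (R : realType) (s : seq nat) : sorted ltn s ->
  \sum_(i <- s) (1 / 2 : R) ^+ i.+1 <= 1.
Proof.
move=> ss; pose M := (\max_(i <- s) i).+1.
have sM i : i \in s -> (i < M)%N by move=> is_; rewrite ltnS; exact: leq_bigmax_seq.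
have -> : s = [seq i <- iota 0 M | i \in s].
  apply: eq_sorted_ltn => // [|i]; last first.
    by rewrite mem_filter mem_iota /= add0n; apply/esym; apply: andb_idr; exact: sM.
  by apply: sorted_filter; [exact: ltn_trans | exact: iota_ltn_sorted].
have p0 i : 0 <= (1 / 2 : R) ^+ i by rewrite exprn_ge0 //; lra.
rewrite big_filter; apply: le_trans (_ : \sum_(i <- iota 0 M) (1 / 2 : R) ^+ i.+1 <= _).
  by rewrite big_mkcond; apply: ler_sum => i _; case: ifP.
suff -> : \sum_(i <- iota 0 M) (1 / 2 : R) ^+ i.+1 = 1 - (1 / 2) ^+ M.
  by rewrite gerBl.
elim: M {sM} => [|M IH]; first by rewrite big_nil expr0 subrr.
by rewrite -[in LHS]addn1 iotaD big_cat /= big_seq1 IH add0n exprS; field.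
Qed.

Lemma flatten_blocks_sorted (e : nat -> seq nat) (s : seq nat) :
  (forall n, sorted ltn (e n)) ->
  (forall m n, (m < n)%N -> all (fun i => all (ltn i) (e n)) (e m)) ->
  sorted ltn s -> sorted ltn (flatten [seq e n | n <- s]).
Proof.
move=> es elt; elim: s => //= n s IH.
rewrite (path_sortedE ltn_trans) => /andP[/allP ns ss].
rewrite sorted_ltn_cat es IH //=; apply/allP => i in_; apply/allP => j.
move=> /flattenP[_ /mapP[m ms ->] jm].
by move: (elt n m (ns _ ms)) => /allP/(_ _ in_)/allP/(_ _ jm).
Qed.

Lemma sorted_le_last (s : seq nat) i : sorted ltn s -> i \in s -> (i <= last 0%N s)%N.
Proof.
case: (lastP s) => // {}s j; rewrite last_rcons mem_rcons inE -cats1 sorted_ltn_cat.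
move=> /and3P[_ _ /allP sj] /orP[/eqP->//|/sj /=].
by rewrite andbT => /ltnW.
Qed.

Section Blocks.
Variables (R : realType) (k : scalar_kind) (p : \bar R).
Hypothesis hp : (1 <= p)%E.
Local Notation K := (scalars R k).
Variables (F H : set {fset nat}).
Hypothesis Fspread : spreading (listed F).
Hypothesis Fpos : forall s, listed F s -> all (ltn 0) s.
Hypothesis Fone : forall n, (0 < n)%N -> listed F [:: n].
Variable M : nat -> nat.
Hypothesis M_incr : {homo M : i j / (i < j)%N}.
Hypothesis FFH : forall s, seq_comp (listed F) (listed F) s -> listed H (map M s).

Lemma lp_seq_nil (c : nat -> K) : lp_seq p [::] c = 0.
Proof.
have -> : lp_seq p [::] c = lp_seq p [::] (fun i => 0 * c i) by exact: eq_lp_seq.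
by rewrite lp_seqZ // absK0 mul0r.
Qed.

Lemma listed_sub_comp s : listed F s -> seq_comp (listed F) (listed F) s.
Proof.
move=> Fs; split; first by case: Fs.
exists [seq [:: i] | i <- s]; split.
- by rewrite flatten_seq1.
- by rewrite -map_comp map_id.
- move=> _ /mapP[i is_ ->]; split=> //; apply: Fone.
  by move/allP: (Fpos Fs) => /(_ _ is_).
Qed.

(** If both [A] and [B] kill the spreading models on [F], then [A + B] kills
    those on [H], which has room for [F]-many members of [F].  On such a
    spreading model [x], [A x] has no lower estimate on any tail, so that there
    are consecutive normalised blocks on which [A] is summably small.  These
    blocks form a spreading model on [F] which [B] nearly maps as [A + B]. *)
Lemma SM_add_blocks (X Y : completeNormedModType K) (A B : {linear X -> Y}) :
  @SM R k p F X Y A -> @SM R k p F X Y B -> @SM R k p H X Y (A \+ B).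
Proof.
move=> smA smB; have /SM_P[bA nA] := smA; have /SM_P[bB nB] := smB.
apply/SM_P; split; first exact: bounded_operatorD.
move=> x /spreading_modelP[[a1 a10 lx] [b b0 ux]] a a0 lAB.
pose FF := seq_comp (listed F) (listed F); pose u := x \o M.
have {lx}lu : lower p FF u a1 by apply: lower_sub lx.
have {ux}uu : upper p FF u b by apply: upper_sub ux.
have {lAB}lABu : lower p FF ((A \+ B) \o u) a.
  exact: (@lower_sub _ _ _ _ _ _ ((A \+ B) \o x) a M M_incr FFH lAB).
have small (m : nat) (e : R) : 0 < e -> exists sc : seq nat * (nat -> K),
    [/\ listed F sc.1, all (ltn m) sc.1, lp_seq p sc.1 sc.2 = 1
      & nrm (comb (A \o u) sc.1 sc.2) <= e].
  move=> e0; pose f := addn m.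
  have f_incr : {homo f : i j / (i < j)%N} by move=> i j; rewrite ltn_add2l.
  have Ff s : listed F s -> FF (map f s).
    by move=> Fs; apply: listed_sub_comp; apply: Fspread.
  have ufF : spreading_model p F (u \o f).
    apply/spreading_modelP; split; [exists a1|exists b] => //.
      exact: lower_sub lu.
    exact: upper_sub uu.
  have e'0 : 0 < e^-1 by rewrite invr_gt0.
  have := nA _ ufF _ e'0; apply: contra_notP => nosc s Fs c.
  rewrite leNgt; apply/negP => lt; apply: nosc.
  have l0 : 0 < lp_seq p s c.
    by apply: le_lt_trans lt; rewrite mulr_ge0 ?nrm_ge0 ?(ltW e'0).
  pose t := emb k (lp_seq p s c)^-1.
  have at_ : absK t = (lp_seq p s c)^-1 by rewrite absK_emb ger0_norm // invr_ge0 ltW.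
  have [g gK] := incr_inv f_incr.
  have cgf : (fun i => t * (c \o g) i) \o f = (fun i => t * c i).
    by apply/funext => i /=; rewrite gK.
  exists (map f s, fun i => t * (c \o g) i) => /=; split.
  - exact: Fspread.
  - apply/allP => _ /mapP[i is_ ->]; rewrite /f /=.
    by have /= i0 := allP (Fpos Fs) _ is_; lia.
  - by rewrite lp_seq_map cgf lp_seqZ // at_ mulVf // lt0r_neq0.
  - rewrite comb_map cgf combZ nrmZ at_ ler_pdivrMl //.
    by move: lt; rewrite mulrC ltr_pdivrMr // => /ltW; rewrite mulrC.
(* The errors [eps n] add up to at most (2 a)^-1, half of the lower bound for
   A + B. *)
pose eps n : R := (2 * a)^-1 * (1 / 2) ^+ n.+1.
have eps0 n : 0 < eps n.
  by rewrite /eps mulr_gt0 ?invr_gt0 ?mulr_gt0 ?exprn_gt0 //; lra.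
have /choice[G GP] mn := small mn.1 (eps mn.2) (eps0 mn.2).
pose ec := fix ec n := G (if n is n'.+1 then last 0%N (ec n').1 else 0%N, n).
pose e n := (ec n).1; pose cs n := (ec n).2.
have ecE n : exists m, ec n = G (m, n).
  by case: n => [|n]; [exists 0%N | exists (last 0%N (ec n).1)].
have eF n : listed F (e n) by rewrite /e; have [m ->] := ecE n; case: (GP (m, n)).
have e1 n : lp_seq p (e n) (cs n) = 1.
  by rewrite /e /cs; have [m ->] := ecE n; case: (GP (m, n)).
have eA n : nrm (comb (A \o u) (e n) (cs n)) <= eps n.
  by rewrite /e /cs; have [m ->] := ecE n; case: (GP (m, n)).
have en0 n : e n != [::].
  by apply/eqP => en; move: (e1 n); rewrite en lp_seq_nil => /eqP; rewrite eq_sym oner_eq0.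
have es n : sorted ltn (e n) by case: (eF n).
have eS n : all (ltn (last 0%N (e n))) (e n.+1) by case: (GP (last 0%N (e n), n.+1)).
have e_lt m n : (m < n)%N -> all (fun i => all (ltn i) (e n)) (e m).
  have step q : forall i j, i \in e q -> j \in e q.+1 -> (i < j)%N.
    move=> i j iq /(allP (eS q)) /=; apply: leq_ltn_trans.
    exact: sorted_le_last (es q) iq.
  move=> mn; suff lt i j : i \in e m -> j \in e n -> (i < j)%N.
    by apply/allP => i im; apply/allP => j jn; exact: lt.
  elim: n mn j => // n IH; rewrite ltnS leq_eqVlt => /orP[/eqP->|mn] j im jn.
    exact: step im jn.
  have hn : head 0%N (e n) \in e n.
    by case: (e n) (en0 n) => // q t _; exact: mem_head.
  exact: ltn_trans (IH mn _ im hn) (step n _ _ hn jn).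
pose h n := head 0%N (e n).
have hP n : h n \in e n by rewrite /h; case: (e n) (en0 n) => // q t _; exact: mem_head.
have h_incr : {homo h : i j / (i < j)%N}.
  by move=> i j /e_lt/allP/(_ _ (hP i))/allP; apply.
have /choice[blk blkP] i : exists n, forall m, i \in e m -> m = n.
  have [[n ein]|no] := EM (exists n, i \in e n); last by exists 0%N => m em; case: no; exists m.
  exists n => m em; case: (ltngtP m n) => // /e_lt/allP.
    by move=> /(_ _ em)/allP/(_ _ ein) /=; rewrite ltnn.
  by move=> /(_ _ ein)/allP/(_ _ em) /=; rewrite ltnn.
have flF s : listed F s -> FF (flatten [seq e n | n <- s]).
  move=> Fs; split; first by apply: flatten_blocks_sorted => //; case: Fs.
  exists [seq e n | n <- s]; split=> //.
    by rewrite -map_comp; exact: Fspread.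
  by move=> _ /mapP[n _ ->].
pose w n := comb u (e n) (cs n).
pose C (c : nat -> K) i := c (blk i) * cs (blk i) i.
have lpC s c : listed F s -> lp_seq p (flatten [seq e n | n <- s]) (C c) = lp_seq p s c.
  move=> Fs; apply: (lp_seq_blocks hp (cs := cs)) => n ns; first exact: e1.
  by move=> i in_; rewrite /C -(blkP i n).
have combC (Z : completeNormedModType K) (L : {linear X -> Z}) s c :
    comb (L \o w) s c = comb (L \o u) (flatten [seq e n | n <- s]) (C c).
  rewrite /comb big_flatten big_map; apply: eq_bigr => n _.
  rewrite /= /w comb_image /comb scaler_sumr; apply: eq_big_seq => i in_.
  by rewrite scalerA /C -(blkP i n).
have wF : spreading_model p F w.
  apply/spreading_modelP; split; [exists a1|exists b] => // s Fs c;
    rewrite -(lpC s c Fs) (combC _ idfun); [apply: lu | apply: uu]; exact: flF.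
apply: (nB w wF (2 * a)); first by rewrite mulr_gt0.
move=> s Fs c.
have lw : lp_seq p s c <= a * nrm (comb ((A \+ B : {linear X -> Y}) \o w) s c).
  by rewrite combC -(lpC s c Fs); apply: lABu; exact: flF.
have wE : comb ((A \+ B : {linear X -> Y}) \o w) s c = comb (A \o w) s c + comb (B \o w) s c.
  by rewrite /comb -big_split /=; apply: eq_bigr => n _; rewrite -scalerDr.
have Aw : nrm (comb (A \o w) s c) <= lp_seq p s c * (2 * a)^-1.
  apply: le_trans (nrm_sum _ _) _.
  apply: le_trans (_ : \sum_(n <- s) lp_seq p s c * eps n <= _).
    rewrite !big_seq; apply: ler_sum => n ns; rewrite nrmZ.
    apply: ler_pM; rewrite ?absK_ge0 ?nrm_ge0 //; first exact: lp_seq_abs.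
    by rewrite /= /w comb_image.
  rewrite -mulr_sumr ler_wpM2l ?lp_seq_ge0 // /eps -mulr_sumr ger_pMr ?invr_gt0 ?mulr_gt0 //.
  by apply: sum_geometric_le; case: Fs.
have : a * nrm (comb (A \o w) s c) <= lp_seq p s c / 2.
  rewrite (_ : _ / 2 = a * (lp_seq p s c * (2 * a)^-1)); first by rewrite ler_wpM2l // ltW.
  by field; rewrite lt0r_neq0.
have := nrmD (comb (A \o w) s c) (comb (B \o w) s c).
rewrite wE in lw; move=> le1 le2.
have le3 : a * nrm (comb (A \o w) s c + comb (B \o w) s c) <=
    a * (nrm (comb (A \o w) s c) + nrm (comb (B \o w) s c)) by rewrite ler_wpM2l // ltW.
lra.
Qed.

End Blocks.

(** * The Hahn-Banach theorem *)

Section HahnBanach.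
Variables (R : realType) (k : scalar_kind).
Local Notation K := (scalars R k).
Local Notation re := (@real_part R k).
Local Notation emb := (emb k).
Variable Y : completeNormedModType K.
Implicit Types (G : set (Y * R)) (v : Y).

(** A real-linear functional on a real subspace, given by its graph; the bound
    by the norm makes the relation single valued. *)
Definition dominated_graph G : Prop :=
  [/\ G (0, 0),
      forall r u w, G u -> G w -> G (emb r *: u.1 + w.1, r * u.2 + w.2)
    & forall u, G u -> u.2 <= nrm u.1].

Lemma dominated_scale G r u : dominated_graph G -> G u -> G (emb r *: u.1, r * u.2).
Proof. by move=> [G0 GL _] Gu; have := GL r u _ Gu G0; rewrite /= !addr0. Qed.

Lemma dominated_add G u w : dominated_graph G -> G u -> G w -> G (u.1 + w.1, u.2 + w.2).
Proof. by move=> [_ GL _] Gu Gw; have := GL 1 u w Gu Gw; rewrite emb1 scale1r mul1r. Qed.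

(** One more dimension: the admissible values at [v] fill the interval between
    the supremum of u.2 - |u.1 - v| and the infimum of |w.1 + v| - w.2. *)
Lemma dominated_extend G v : dominated_graph G -> exists2 G',
  dominated_graph G' & G `<=` G' /\ exists t, G' (v, t).
Proof.
move=> dG; have [G0 GL Gle] := dG.
pose lo := [set u.2 - nrm (u.1 - v) | u in G].
have lo_le u w : G u -> G w -> u.2 - nrm (u.1 - v) <= nrm (w.1 + v) - w.2.
  move=> Gu Gw; have := Gle _ (dominated_add dG Gu Gw) => /=.
  have := nrmD (u.1 - v) (w.1 + v); rewrite addrACA addNr addr0.
  by lra.
have lo0 : has_sup lo.
  split; first by exists (0 - nrm (0 - v)), (0, 0).
  exists (nrm (0 + v) - 0) => _ [u Gu <-]; exact: (lo_le u (0, 0)).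
pose t := sup lo.
have t_ge u : G u -> u.2 - nrm (u.1 - v) <= t.
  by move=> Gu; apply: sup_ubound; [case: lo0 | exists u].
have t_le w : G w -> t <= nrm (w.1 + v) - w.2.
  move=> Gw; apply: sup_le_ub; first by case: lo0.
  by move=> _ [u Gu <-]; exact: lo_le.
exists [set w | exists u r, G u /\ w = (u.1 + emb r *: v, u.2 + r * t)]; last first.
  split=> [u Gu|].
    by exists u, 0; rewrite emb0 scale0r mul0r !addr0; split=> //; case: u Gu.
  by exists t, (0, 0), 1; rewrite emb1 scale1r mul1r !add0r.
split.
- by exists (0, 0), 0; rewrite emb0 scale0r mul0r !addr0.
- move=> r _ _ [u [a [Gu ->]]] [w [b [Gw ->]]].
  exists (emb r *: u.1 + w.1, r * u.2 + w.2), (r * a + b) => /=; split; first exact: GL.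
  rewrite emb_add emb_mul scalerDr scalerDl scalerA; congr pair; last by ring.
  by rewrite addrACA.
move=> _ [u [r [Gu ->]]] /=; have [r0|r0|->] := ltgtP r 0.
- have s0 : 0 < - r by rewrite oppr_gt0.
  have := t_ge _ (dominated_scale (- r)^-1 dG Gu) => /= h.
  have uE : u.1 + emb r *: v = emb (- r) *: (emb (- r)^-1 *: u.1 - v).
    rewrite scalerBr scalerA -emb_mul divff ?lt0r_neq0 // emb1 scale1r emb_opp.
    by rewrite scaleNr opprK.
  rewrite uE nrmZ absK_emb gtr0_norm //.
  have := ler_wpM2l (ltW s0) h; rewrite mulrBr mulrA divff ?lt0r_neq0 // mul1r; lra.
- have := t_le _ (dominated_scale r^-1 dG Gu) => /= h.
  have uE : u.1 + emb r *: v = emb r *: (emb r^-1 *: u.1 + v).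
    by rewrite scalerDr scalerA -emb_mul divff ?lt0r_neq0 // emb1 scale1r.
  rewrite uE nrmZ absK_emb gtr0_norm //.
  have := ler_wpM2l (ltW r0) h; rewrite mulrBr [r * (_ * _)]mulrA divff ?lt0r_neq0 // mul1r; lra.
- by rewrite emb0 scale0r mul0r !addr0; exact: Gle.
Qed.

Lemma dominated_total G : dominated_graph G -> exists2 H,
  dominated_graph H & G `<=` H /\ forall v, exists t, H (v, t).
Proof.
move=> dG; have [G0 GL Gle] := dG.
(* Graphs are taken together with [G], so that the empty chain is bounded. *)
have [|H [dH Hmax]] := @Zorn_bigcup _ [set H | dominated_graph (G `|` H)].
  move=> F FP Ftot; have common u w : (G `|` \bigcup_(H in F) H) u ->
      (G `|` \bigcup_(H in F) H) w ->
      exists H, [/\ dominated_graph (G `|` H), H `<=` \bigcup_(H in F) H,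
                    (G `|` H) u & (G `|` H) w].
    case=> [Gu|[H FH Hu]] [Gw|[H' FH' Hw]].
    - by exists set0; split; [rewrite setU0|move=> ? []|left|left].
    - by exists H'; split; [exact: FP|move=> ? ?; exists H'|left|right].
    - by exists H; split; [exact: FP|move=> ? ?; exists H|right|left].
    - have [HH'|H'H] := Ftot _ _ FH FH'.
        by exists H'; split; [exact: FP|move=> ? ?; exists H'|right; exact: HH'|right].
      by exists H; split; [exact: FP|move=> ? ?; exists H|right|right; exact: H'H].
  have sub H : H `<=` \bigcup_(H in F) H -> G `|` H `<=` G `|` \bigcup_(H in F) H.
    by move=> HF u [Gu|/HF]; [left|right].
  split; first by left.
    move=> r u w Uu Uw; have [H [[_ HL _] HF Hu Hw]] := common u w Uu Uw.
    by apply: sub HF _ _; exact: HL.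
  move=> u Uu; have [H [[_ _ Hle] _ Hu _]] := common u u Uu Uu.
  exact: Hle.
exists (G `|` H) => //; split=> [u Gu|v]; first by left.
have [G' dG' [GG' [t tv]]] := dominated_extend v dH.
exists t; right; apply: contrapT => nHt.
apply: (Hmax G'); last first.
  by rewrite /= (_ : G `|` G' = G') //; apply/setUidPr => u Gu; apply: GG'; left.
by split=> [u Hu|G'H]; [apply: GG'; right | apply: nHt; apply: G'H].
Qed.

Definition contractive (f : Y -> K) : Prop :=
  [/\ forall u v, f (u + v) = f u + f v, forall c v, f (c *: v) = c * f v
    & forall v, absK (f v) <= nrm v].

Theorem Hahn_Banach G : dominated_graph G ->
  exists2 f, contractive f & forall u, G u -> re (f u.1) = u.2.
Proof.
move=> /dominated_total[H dH [GH /choice[g gH]]]; have [H0 HL Hle] := dH.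
have g_uniq v t : H (v, t) -> g v = t.
  move=> Ht; have := Hle _ (HL (-1) _ _ (gH v) Ht); have := Hle _ (HL (-1) _ _ Ht (gH v)).
  by rewrite /= emb_opp emb1 scaleN1r addNr nrm0; lra.
have gD u v : g (u + v) = g u + g v.
  by apply: g_uniq; exact: dominated_add dH (gH u) (gH v).
have gZ r v : g (emb r *: v) = r * g v.
  by apply: g_uniq; exact: dominated_scale dH (gH v).
have gN v : g (- v) = - g v by rewrite -scaleN1r -(emb1 R) -emb_opp gZ mulN1r.
pose f v := emb (g v) - iu R k * emb (g (iu R k *: v)).
have fD u v : f (u + v) = f u + f v.
  by rewrite /f scalerDr !gD !emb_add; ring.
have fr r v : f (emb r *: v) = emb r * f v.
  by rewrite /f scalerA [_ * emb r]mulrC -scalerA !gZ !emb_mul; ring.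
have fi v : f (iu R k *: v) = iu R k * f v.
  rewrite /f scalerA; case: (iu_cases R k) => [->|ii].
    by rewrite !mul0r scale0r (g_uniq _ _ H0) emb0 subr0.
  by rewrite ii scaleN1r gN emb_opp mulrBr mulrA ii; ring.
have fZ c v : f (c *: v) = c * f v.
  by rewrite {1}[c]scalarE scalerDl -scalerA fD fi !fr {3}[c]scalarE; ring.
have ref v : re (f v) = g v.
  by rewrite /f re_add re_opp re_iu_emb embK subr0.
exists f; last by move=> [v t] /GH Ht /=; rewrite ref; apply: g_uniq.
split=> // v; have [->|fv0] := eqVneq (f v) 0; first by rewrite absK0 nrm_ge0.
pose c := emb (absK (f v)) / f v.
have c1 : absK c = 1.
  by rewrite absKM absKV absK_emb ger0_norm ?absK_ge0 // divff // absK_eq0.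
have <- : re (f (c *: v)) = absK (f v) by rewrite fZ /c mulfVK // embK.
rewrite ref; apply: le_trans (Hle _ (gH _)) _ => /=.
by rewrite nrmZ c1 mul1r.
Qed.

(** The lower estimate says that the functional with the prescribed values on
    the span of the z i is bounded by the norm. *)
Lemma functional_of_lower (z : nat -> Y) (s : seq nat) (a : R) (th : nat -> bool) :
  uniq s -> 0 < a ->
  (forall c : nat -> K, \sum_(i <- s) absK (c i) <= a * nrm (comb z s c)) ->
  exists2 f, contractive f & forall i, i \in s -> f (z i) = emb a^-1 * sgnK R k (th i).
Proof.
move=> us a0 la.
pose phi (c : nat -> K) := a^-1 * re (\sum_(i <- s) sgnK R k (th i) * c i).
pose G : set (Y * R) := [set u | exists c, u = (comb z s c, phi c)].
have [|f cf fG] := @Hahn_Banach G.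
  split.
  - exists (fun=> 0); rewrite /comb /phi !big1 => [|i _|i _]; rewrite ?mulr0 ?scale0r //.
    by rewrite -(emb0 R) embK mulr0.
  - move=> r _ _ [c ->] [c' ->] /=; exists (fun i => emb r * c i + c' i); congr pair.
      rewrite -combZ /comb -big_split; apply: eq_bigr => i _ /=.
      by rewrite scalerDl.
    rewrite /phi mulrCA -mulrDr -re_emb_mul -re_add mulr_sumr -big_split.
    by congr (_ * re _); apply: eq_bigr => i _ /=; ring.
  - move=> _ [c ->] /=; rewrite /phi ler_pdivrMl //.
    apply: le_trans (la c); apply: le_trans (ler_norm _) _.
    apply: le_trans (norm_re_le _) _; apply: le_trans (absK_sum _ _) _.
    apply: ler_sum => i _; rewrite absKM (_ : absK (sgnK R k _) = 1) ?mul1r //.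
    by rewrite /sgnK; case: (th i); rewrite ?absKN absK1.
exists f => // i is_; have [_ fZ _] := cf.
have fc (c : K) : re (c * f (z i)) = a^-1 * re (c * sgnK R k (th i)).
  rewrite -fZ; have := fG (_, _) (ex_intro _ (fun j => if j == i then c else 0) erefl) => /=.
  rewrite /phi /comb (bigD1_seq i) //= [X in _ + X]big1 => [|j /negPf ji]; last first.
    by rewrite ji scale0r.
  rewrite eqxx addr0 => ->; rewrite (bigD1_seq i) //= eqxx big1 => [|j /negPf ji]; last first.
    by rewrite ji mulr0.
  by rewrite addr0 [_ * c]mulrC.
have sgE : sgnK R k (th i) = emb (if th i then 1 else -1).
  by rewrite /sgnK; case: (th i); rewrite ?emb_opp emb1.
(* The real part of f (z i) is [fc 1]; its imaginary part vanishes by [fc iu]. *)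
have := fc 1; rewrite !mul1r sgE embK => fre.
rewrite -emb_mul -fre; apply: re_iu_eq0.
by rewrite fc sgE re_iu_emb mulr0.
Qed.

End HahnBanach.

(** * Sums of operators: the case of l_1 *)

Section EllOne.
Variables (R : realType) (k : scalar_kind).
Local Notation K := (scalars R k).
Variable Y : completeNormedModType K.

(** Small discs instead of half-planes around the two values [g.1] and [g.2],
    so as to control complex coefficients as well. *)
Definition separated (z : nat -> Y) (e : R) (g : K * K) : set (seq (nat * bool)) :=
  [set sg : seq (nat * bool) | exists2 f : Y -> K, contractive f & forall q, q \in sg ->
     absK (f (z q.1) - (if q.2 then g.1 else g.2)) <= e].

Lemma hereditary_separated z e g : hereditary (separated z e g).
Proof.
by move=> s t st [f cf fP]; exists f => // q qs; apply: fP; apply: (mem_subseq st).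
Qed.

(** If all signs can be separated then the difference of two functionals that
    correspond to opposite signs is close to a multiple of these signs. *)
Lemma lower_of_separated (z : nat -> Y) (l : nat -> nat) (F : set (seq nat))
    (e dl : R) (g : K * K) :
  0 < dl -> e = dl / 16 -> dl - 2 * e <= absK (g.1 - g.2) ->
  (forall s, F s -> forall th, separated z e g [seq (l i, th i) | i <- s]) ->
  lower 1%E F (z \o l) (8 / dl).
Proof.
move=> dl0 eE gdl sep s Fs c; rewrite lp_seq1 //.
have [th thP] := scalar_signs s c.
have [f [fD fZ fle] fP] := sep s Fs th.
have [f' [fD' fZ' fle'] fP'] := sep s Fs (fun i => ~~ th i).
have f_sum (h : Y -> K) : (forall u v, h (u + v) = h u + h v) ->
    (forall t v, h (t *: v) = t * h v) ->
    h (comb (z \o l) s c) = \sum_(i <- s) c i * h (z (l i)).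
  move=> hD hZ; rewrite /comb (big_morph h hD (_ : h 0 = 0)).
    by apply: eq_bigr => i _; rewrite hZ.
  by rewrite -(scale0r (0 : Y)) hZ mul0r.
set sm := \sum_(i <- s) absK (c i) in thP *.
set T := \sum_(i <- s) sgnK R k (th i) * c i in thP.
have close : absK (f (comb (z \o l) s c) - f' (comb (z \o l) s c) - (g.1 - g.2) * T)
    <= sm * (2 * e).
  rewrite !f_sum // -sumrB mulr_sumr -sumrB; apply: le_trans (absK_sum _ _) _.
  rewrite mulr_suml !big_seq; apply: ler_sum => i is_.
  rewrite (_ : _ - _ = c i * ((f (z (l i)) - f' (z (l i))) - sgnK R k (th i) * (g.1 - g.2)));
    last by ring.
  rewrite absKM ler_wpM2l ?absK_ge0 //.
  have /fP/= fi : (l i, th i) \in [seq (l i, th i) | i <- s] by apply/mapP; exists i.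
  have /fP'/= fi' : (l i, ~~ th i) \in [seq (l i, ~~ th i) | i <- s].
    by apply/mapP; exists i.
  rewrite mulr2n mulrDl mul1r.
  rewrite (_ : _ - _ = (f (z (l i)) - (if th i then g.1 else g.2)) -
                       (f' (z (l i)) - (if ~~ th i then g.1 else g.2))).
    by apply: le_trans (absKD _ _) _; rewrite absKN lerD.
  by rewrite /sgnK; case: (th i) => /=; ring.
have T_ge : (dl - 2 * e) * absK T <= absK ((g.1 - g.2) * T).
  by rewrite absKM ler_wpM2r ?absK_ge0.
have sm0 : 0 <= sm by apply: sumr_ge0 => i _; exact: absK_ge0.
set v := comb _ s c in close *.
have up : absK ((g.1 - g.2) * T) <= 2 * nrm v + sm * (2 * e).
  rewrite (_ : _ * T = (f v - f' v) - (f v - f' v - (g.1 - g.2) * T)); last by ring.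
  apply: le_trans (absKD _ _) _; rewrite absKN; apply: lerD close.
  apply: le_trans (absKD _ _) _; rewrite absKN.
  by have := fle v; have := fle' v; lra.
have dlT : (dl - 2 * e) * (sm / 2) <= (dl - 2 * e) * absK T.
  by rewrite ler_wpM2l //; lra.
(* Altogether sm * (dl / 2 - 3 * e) <= 2 * nrm v, and dl / 2 - 3 * e is at
   least dl / 4. *)
rewrite mulrAC ler_pdivlMr //; subst e.
have : 0 <= sm * dl by rewrite mulr_ge0 // ltW.
lra.
Qed.

End EllOne.

Lemma uniq_flat (s : seq (nat * nat)) (q q' : nat * nat) : uniq (flat s) ->
  q \in s -> q' \in s -> q.2 != q'.1.
Proof.
have fl : perm_eq (flat s) ([seq q.1 | q <- s] ++ [seq q.2 | q <- s]).
  elim: s => // t s IH; rewrite /flat /= perm_cons.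
  by rewrite perm_sym -cat1s perm_catCA /= perm_cons perm_sym.
rewrite (perm_uniq fl) cat_uniq => /and3P[_ /hasPn no _] qs q's.
have /no : q.2 \in [seq q.2 | q <- s] by apply: map_f.
by apply: contra => /eqP->; apply: map_f.
Qed.

Section EllOneSum.
Variables (d : Order.disp_t) (W : orderType d).
Hypothesis hW : is_omega1 W.
Variable S : W -> set {fset nat}.
Hypothesis hS : schreier_families S.
Variables (R : realType) (k : scalar_kind).
Local Notation K := (scalars R k).

(** A Rosenthal type dichotomy.  When the sums y_i + z_i have a lower l_1
    estimate on S_xi, a functional with alternating signs on them has to
    oscillate on y or on z over each pair of consecutive points.  Colouring
    the pairs by the sequence and by the approximate values concerned, one
    colour is large, hence available for all signs along a subsequence. *)
Lemma lower_l1_add (xi : W) (Y : completeNormedModType K) (y z : nat -> Y) (D a : R) :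
  ~ ord_zero xi -> 0 < a ->
  (forall i, (0 < i)%N -> nrm (y i) <= D /\ nrm (z i) <= D) ->
  lower 1%E (listed (S xi)) (fun i => y i + z i) a ->
  exists2 l : nat -> nat, {homo l : i j / (i < j)%N} &
    exists2 a', 0 < a' & lower 1%E (listed (S xi)) (y \o l) a' \/
                         lower 1%E (listed (S xi)) (z \o l) a'.
Proof.
move=> xi0 a0 yzD lyz.
pose dl := a^-1; have dl0 : 0 < dl by rewrite invr_gt0.
pose e := dl / 16; have e0 : 0 < e by apply: divr_gt0; lra.
have [gs gsP] := @scalar_grid R k D e e0.
pose w (b : bool) := if b then y else z.
pose col : seq (bool * (K * K)) :=
  [seq bg <- [seq (b, g) | b <- [:: true; false], g <- [seq (g, g') | g <- gs, g' <- gs]]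
     | dl - 2 * e <= absK (bg.2.1 - bg.2.2)].
pose F (bg : bool * (K * K)) : set (seq (nat * nat)) :=
  [set s | separated (w bg.1) e bg.2 (signed_flat s)].
have hF bg : hereditary (F bg).
  move=> s t st; apply: hereditary_separated; exact: subseq_signed_flat.
have [|U [UU U_free _]] := @free_ultrafilter setT.
  by move=> m; exists m.+1.
have colourF : large hW (on_pairs U) xi (colourable col F).
  have := large_pairs UU xi0 (large_Sq UU U_free hW hS xi 0).
  apply: large_mono => [P Q|s [Es /allP Epos]]; first exact: (on_pairs_mono UU).
  have us : uniq (flat s) by have := Sq_sorted Es; rewrite ltn_sorted_uniq_leq => /andP[].
  pose th i := i \in [seq q.1 | q <- s].
  have [|f cf fE] := @functional_of_lower R k Y (fun i => y i + z i) (flat s) a th us a0.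
    by move=> c; have := lyz _ Es c; rewrite lp_seq1.
  have th1 q : q \in s -> th q.1 = true by move=> qs; apply: map_f.
  have th2 q : q \in s -> th q.2 = false.
    move=> qs; apply/negbTE/mapP => -[q' q's /eqP]; apply/negP.
    exact: uniq_flat us qs q's.
  have in1 q : q \in s -> q.1 \in flat s.
    by move=> qs; apply/flattenP; exists [:: q.1; q.2]; rewrite ?mem_head //; apply/mapP; exists q.
  have in2 q : q \in s -> q.2 \in flat s.
    by move=> qs; apply/flattenP; exists [:: q.1; q.2];
      rewrite ?inE ?eqxx ?orbT //; apply/mapP; exists q.
  have [fD fZ fle] := cf.
  have fw b i : i \in flat s -> absK (f (w b i)) <= D.
    move=> /Epos/yzD[yD zD]; apply: le_trans (fle _) _.
    by rewrite /w; case: b.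
  have /choice[c cP] q : exists bg, q \in s -> bg \in col /\
      absK (f (w bg.1 q.1) - bg.2.1) <= e /\ absK (f (w bg.1 q.2) - bg.2.2) <= e.
    have [qs|] := boolP (q \in s); last by exists (true, (0, 0)).
    (* The sums differ by 2 * dl under [f], so one of the two terms differs by
       at least dl. *)
    have [b osc] : exists b, dl <= absK (f (w b q.1) - f (w b q.2)).
      apply: contrapT => nob.
      have osc b : absK (f (w b q.1) - f (w b q.2)) < dl.
        by rewrite ltNge; apply/negP => h; apply: nob; exists b.
      have := ltrD (osc true) (osc false); apply/negP; rewrite -leNgt.
      apply: le_trans (absKD _ _).
      rewrite (_ : _ + _ = f (y q.1 + z q.1) - f (y q.2 + z q.2)); last first.
        by rewrite !fD /w; ring.
      rewrite !fE ?in1 ?in2 // th1 // th2 // /sgnK mulr1 mulrN1 opprK -emb_add absK_emb.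
      by rewrite ger0_norm // addr_ge0 // ltW.
    have [g ggs gP] := gsP _ (fw b _ (in1 _ qs)).
    have [g' g'gs g'P] := gsP _ (fw b _ (in2 _ qs)).
    exists (b, (g, g')) => _; split=> //; rewrite mem_filter; apply/andP; split=> [/=|].
      have h1 := absKD (f (w b q.1) - g) (g - g').
      have h2 := absKD (f (w b q.1) - g') (g' - f (w b q.2)).
      rewrite addrA subrK in h1; rewrite addrA subrK in h2.
      rewrite -(absKN (g' - _)) opprB in h2; lra.
    by apply: allpairs_f; [case: b {osc gP g'P} | exact: allpairs_f].
  exists c => [q /cP[]//|bg]; exists f => // r /flattenP[_ /mapP[q + ->]].
  rewrite mem_filter => /andP[/eqP cq qs]; have [_ [c1 c2]] := cP q qs.
  by rewrite !inE => /orP[] /eqP-> /=; rewrite -cq.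
have [bg bgcol lF] := large_colouring (on_pairs_mono UU) (on_pairs_or UU) (on_pairs_ex UU) hF colourF.
have [l l_incr lP] := large_extract UU U_free hS (@hereditary_separated _ _ _ (w bg.1) e bg.2) lF.
exists l => //; exists (8 / dl); first by apply: divr_gt0; lra.
have : lower 1%E (listed (S xi)) (w bg.1 \o l) (8 / dl).
  apply: (lower_of_separated dl0 (erefl e) _ lP).
  by move: bgcol; rewrite mem_filter => /andP[].
by rewrite /w; case: (bg.1); [left|right].
Qed.

Lemma SM_l1_add (xi : W) (X Y : completeNormedModType K) (A B : {linear X -> Y}) :
  ~ ord_zero xi -> @SM R k 1%E (S xi) X Y A -> @SM R k 1%E (S xi) X Y B ->
  @SM R k 1%E (S xi) X Y (A \+ B).
Proof.
move=> xi0 /SM_P[bA nA] /SM_P[bB nB]; apply/SM_P; split; first exact: bounded_operatorD.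
move=> x /spreading_modelP[[a1 a10 lx] [b b0 ux]] a a0 lAB.
have /bounded_operatorP[M M0 AM] := bA; have /bounded_operatorP[N N0 BN] := bB.
have xb i : (0 < i)%N -> nrm (x i) <= b.
  move=> i0; have := ux _ (Sq_one hW hS xi i0) (fun=> 1).
  by rewrite lp_seq1 // /comb !big_seq1 scale1r absK1 mulr1.
have [|l l_incr [a' a'0 lAlB]] := @lower_l1_add xi Y (A \o x) (B \o x) (Num.max M N * b) a xi0 a0 _ lAB.
  move=> i /xb xib; split.
    apply: le_trans (AM _) _; apply: ler_pM; rewrite ?nrm_ge0 ?(ltW M0) //.
    by rewrite le_max lexx.
  apply: le_trans (BN _) _; apply: ler_pM; rewrite ?nrm_ge0 ?(ltW N0) //.
  by rewrite le_max lexx orbT.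
have xl : spreading_model 1%E (S xi) (x \o l).
  apply/spreading_modelP; split; [exists a1 | exists b] => //.
    by apply: lower_sub lx => // s; apply: (Sq_spreading hW hS).
  by apply: upper_sub ux => // s; apply: (Sq_spreading hW hS).
case: lAlB; [exact: nA xl _ a'0 | exact: nB xl _ a'0].
Qed.

End EllOneSum.

(** * The ideals *)

Section Ideals.
Variables (R : realType) (k : scalar_kind) (p : \bar R).
Hypothesis hp : (1 <= p)%E.
Local Notation K := (scalars R k).

Lemma SM_operator_ideal (F : set {fset nat}) : admits_short F ->
  (forall (X Y : completeNormedModType K) (A B : {linear X -> Y}),
     @SM R k p F X Y A -> @SM R k p F X Y B -> @SM R k p F X Y (A \+ B)) ->
  operator_ideal (@SM R k p F).
Proof.
move=> Fshort Fadd; split.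
- by move=> X Y A [].
- by move=> X Y A; exact: SM_finite_rank.
- exact: Fadd.
- by move=> X Y t A; exact: SM_scale.
- by move=> V X Y Z C A B; exact: SM_comp.
Qed.

Variables (d : Order.disp_t) (W : orderType d).
Hypothesis hW : is_omega1 W.
Variable pw : W -> W.
Hypothesis hpw : omega_power pw.
Variable S : W -> set {fset nat}.
Hypothesis hS : schreier_families S.

Lemma listed_all s : listed (schreier S None) s <-> sorted ltn s /\ all (ltn 0) s.
Proof.
split=> -[ss pos]; split=> //; first by apply/allP => i is_; apply: pos; rewrite mem_fs.
by move=> i; rewrite mem_fs => /(allP pos).
Qed.

Lemma schreier_spreading xi : spreading (listed (schreier S xi)).
Proof.
case: xi => [a|]; first exact: Sq_spreading.
move=> f f_incr s /listed_all[ss pos]; apply/listed_all; split.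
  exact: sorted_ltn_map.
apply/allP => _ /mapP[i /(allP pos) /= i0 ->]; exact: leq_trans i0 (incr_ge f_incr i).
Qed.

Lemma schreier_short xi : ord_pos xi -> admits_short (schreier S xi).
Proof.
case: xi => [a a0 N|_ N]; first exact: Sq_short.
exists 0%N => s _ ss pos; exact/listed_all.
Qed.

Lemma SM_ord_le (a b : W) (X Y : completeNormedModType K) (A : {linear X -> Y}) :
  (a <= b)%O -> @SM R k p (S a) X Y A -> @SM R k p (S b) X Y A.
Proof.
rewrite le_eqVlt => /orP[/eqP->//|/(Sq_tail hW hS)[m mP]].
apply: (@SM_mono _ _ _ _ _ _ _ (addn m.+1)) => [i j|s Ss]; first by rewrite ltn_add2l.
apply: mP; first by apply: (Sq_spreading hW hS) => // i j; rewrite ltn_add2l.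
by apply/allP => _ /mapP[i _ ->] /=; rewrite addSn ltnS leq_addr.
Qed.

Lemma SM_all_add (X Y : completeNormedModType K) (A B : {linear X -> Y}) :
  @SM R k p (schreier S None) X Y A -> @SM R k p (schreier S None) X Y B ->
  @SM R k p (schreier S None) X Y (A \+ B).
Proof.
apply: (@SM_add_blocks _ _ _ hp _ _ _ _ _ id) => //.
- exact: schreier_spreading.
- by move=> s /listed_all[].
- by move=> n n0; apply/listed_all; rewrite /= n0.
- move=> s [ss [ts [sE _ Ht]]]; rewrite map_id; apply/listed_all; split=> //.
  rewrite sE; apply/allP => i /flattenP[t /Ht[_ /listed_all[_ /allP]]]; exact.
Qed.

Lemma SM_below_ideal xi : ord_pos xi -> operator_ideal (@SM_below R k p d W pw S xi).
Proof.
move=> xipos; split.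
- by move=> X Y A [z _ []].
- move=> X Y A bA fA; have [z [z0 zxi]] := lt_omega_power_ex hW hpw xipos.
  by exists z => //; apply: SM_finite_rank => //; exact: (@schreier_short (Some z)).
- move=> X Y A B [z [z0 zxi] zA] [z' [z'0 z'xi] z'B].
  have [add addP add_lt] := lt_omega_power_add hW hpw xi.
  pose m := Order.max z z'.
  have mxi : lt_omega_power pw m xi by rewrite /m; case: leP.
  have m0 : ~ ord_zero m by rewrite /m; case: leP.
  exists (add m m).
    split; last exact: add_lt.
    have [y y0] := ord_zero_ex hW.
    apply: ord_lt_pos (lt_le_trans (ord_pos_lt y0 m0) _); exact: add_ge1.
  have [M [M_incr MP]] := Sq_comp_sub hW hS addP m m.
  apply: (SM_add_blocks hp _ _ _ M_incr MP).
  + exact: Sq_spreading.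
  + by move=> s; exact: Sq_pos.
  + by move=> n; exact: Sq_one.
  + by apply: SM_ord_le zA; rewrite /m le_max lexx.
  + by apply: SM_ord_le z'B; rewrite /m le_max lexx orbT.
- by move=> X Y t A [z zP zA]; exists z => //; exact: SM_scale.
- move=> V X Y Z C A B bC [z zP zA] bB; exists z => //; exact: SM_comp.
Qed.

(** Closedness for xi = omega_1: a limit involves countably many classes
    SM^zeta, all of them contained in one SM^beta. *)
Lemma SM_below_closed : closed_class (@SM_below R k p d W pw S None).
Proof.
move=> X Y A bA Aclose.
have /choice[Bz BzP] n : exists Bz : {linear X -> Y} * W,
    [/\ ord_pos (Some Bz.2), @SM R k p (S Bz.2) X Y Bz.1
      & forall x, `|A x - Bz.1 x| <= emb k n.+1%:R^-1 * `|x|].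
  have [|B [z [z0 _] zB] ABn] := Aclose (emb k n.+1%:R^-1).
    by rewrite -(emb0 R) emb_lt invr_gt0 ltr0n.
  by exists (B, z).
have [b bP] := ord_seq_bound hW (fun n => (Bz n).2).
exists b.
  split; last exact: lt_omega_power_None.
  have [y y0] := ord_zero_ex hW; have [z0 _ _] := BzP 0%N.
  exact: ord_lt_pos (lt_le_trans (ord_pos_lt y0 z0) (bP 0%N)).
apply: SM_closed => // e e0.
have eE : e = emb k (real_part e) by rewrite ge0_embK // ltW.
have re0 : 0 < real_part e by rewrite -(emb_lt k) emb0 -eE.
pose n := Num.truncn (real_part e)^-1.
have [_ Bn ABn] := BzP n; exists (Bz n).1; first exact: SM_ord_le (bP n) Bn.
move=> x; apply: le_trans (ABn x) _; rewrite ler_wpM2r ?normr_ge0 //.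
rewrite eE emb_le invf_ple ?posrE ?ltr0n //; apply: ltW; exact: truncnS_gt.
Qed.

End Ideals.

Theorem theorem4p3 (R : realType) (k : scalar_kind)
    (d : Order.disp_t) (W : orderType d) (hW : is_omega1 W)
    (pw : W -> W) (hpw : omega_power pw)
    (S : W -> set {fset nat}) (hS : schreier_families S)
    (p : \bar R) (hp : (1 <= p)%E)
    (xi : option W) (hxi : ord_pos xi) :
  [/\ operator_ideal (@SM_below R k p d W pw S xi),
      xi = None -> closed_class (@SM_below R k p d W pw S xi)
    & p = 1%E \/ p = +oo%E ->
        operator_ideal (@SM R k p (schreier S xi)) /\
        closed_class (@SM R k p (schreier S xi))].
Proof.
split; first exact: SM_below_ideal.
  by move=> ->; exact: SM_below_closed.
move=> p1oo; split; last exact: SM_closed.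
apply: SM_operator_ideal => //; first exact: schreier_short.
move=> X Y A B; case: p1oo hp => -> {}hp.
  case: xi hxi => [a|] a0; last exact: SM_all_add.
  exact: SM_l1_add.
apply: SM_c0_add; [exact: schreier_spreading | exact: schreier_short].
Qed.
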